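(* Let $\mathbf{G}=\mathbf{G}(a,b)$. Then $$\Psi(0,0;\mathbf{G})=4\left(\mathbf{G}^{-1}\sigma_3\mathbf{G}\right)_{12}=8\,\mathfrak{a}\mathfrak{b}\,\mathrm{e}^{-\mathrm{i}\arg(ab)}=\frac{8a^*b^*}{|a|^2+|b|^2},$$ where $\mathfrak{a}:=|a|/\sqrt{|a|^2+|b|^2}$ and $\mathfrak{b}:=|b|/\sqrt{|a|^2+|b|^2}$ (the third expression being read as $0$ if $ab=0$).
   Context: Notation: $*$ is complex conjugation; $\sigma_3=\mathrm{diag}(1,-1)$; $\mathrm{e}^{f\sigma_3}=\mathrm{diag}(\mathrm{e}^{f},\mathrm{e}^{-f})$. For $(a,b)\in\mathbb{C}^2\setminus\{(0,0)\}$ let $$\mathbf{G}(a,b)=\frac{1}{\sqrt{|a|^2+|b|^2}}\begin{bmatrix}a & b^*\\ -b & a^*\end{bmatrix}.$$ For $(X,T)\in\mathbb{R}^2$ and $\mathbf{G}=\mathbf{G}(a,b)$, $\mathbf{P}(\Lambda;X,T,\mathbf{G})$ denotes the unique (it is known to exist) $2\times 2$ matrix function of $\Lambda$ such that: (i) it is analytic for $|\Lambda|\neq 1$ and takes continuous boundary values on the unit circle from the interior and from the exterior; (ii) writing $\mathbf{P}_+$ (resp. $\mathbf{P}_-$) for the boundary value on $|\Lambda|=1$ from the exterior (resp. interior), $$\mathbf{P}_+=\mathbf{P}_-\,\mathrm{e}^{-\mathrm{i}(\Lambda X+\Lambda^2T+2\Lambda^{-1})\sigma_3}\,\mathbf{G}\,\mathrm{e}^{\mathrm{i}(\Lambda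 X+\Lambda^2T+2\Lambda^{-1})\sigma_3},\quad |\Lambda|=1;$$ (iii) $\mathbf{P}\to\mathbb{I}$ as $\Lambda\to\infty$. Then $\Psi(X,T;\mathbf{G}):=2\mathrm{i}\lim_{\Lambda\to\infty}\Lambda P_{12}(\Lambda;X,T,\mathbf{G})$. *)

(* Defs.v *)
From Stdlib Require Import Reals Lra Lia ClassicalEpsilon.
From Coquelicot Require Import Coquelicot.
Open Scope R_scope.

Definition Cexp (z : C) : C :=
  (exp (Re z) * cos (Im z), exp (Re z) * sin (Im z)).

(* Principal argument in (-PI, PI]; the value at 0 is irrelevant. *)
Definition Carg (z : C) : R :=
  if Rle_dec 0 (Im z) then acos (Re z / Cmod z) else - acos (Re z / Cmod z).

Definition M2 : Type := @matrix C 2 2.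

Definition mat2 (m11 m12 m21 m22 : C) : M2 :=
  ((m11, (m12, tt)), ((m21, (m22, tt)), tt)).

(* Coquelicot matrix indices start at 0, so the (1,2) entry is [entry M 0 1]. *)
Definition entry (M : M2) (i j : nat) : C := coeff_mat (RtoC 0) M i j.

Definition mul2 (A B : M2) : M2 := @Mmult C_Ring 2 2 2 A B.

Definition id2 : M2 := @Mone C_Ring 2.

Definition det2 (M : M2) : C :=
  (entry M 0 0 * entry M 1 1 - entry M 0 1 * entry M 1 0)%C.

(* Meaningful when [det2 M <> 0]; see [inv2_l] and [inv2_r]. *)
Definition inv2 (M : M2) : M2 :=
  mat2 (entry M 1 1 / det2 M)%C (- entry M 0 1 / det2 M)%C
       (- entry M 1 0 / det2 M)%C (entry M 0 0 / det2 M)%C.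

Definition sigma3 : M2 := mat2 1 0 0 (- 1)%C.

Definition exp_sigma3 (f : C) : M2 := mat2 (Cexp f) 0 0 (Cexp (- f)%C).

Definition Gmat (a b : C) : M2 :=
  let s : C := RtoC (sqrt (Cmod a ^ 2 + Cmod b ^ 2)) in
  mat2 (a / s)%C (Cconj b / s)%C (- b / s)%C (Cconj a / s)%C.

Definition phase (X T : R) (L : C) : C := (L * X + L ^ 2 * T + 2 * / L)%C.

Definition jump (X T : R) (G : M2) (L : C) : M2 :=
  mul2 (mul2 (exp_sigma3 (- (Ci * phase X T L))%C) G)
       (exp_sigma3 (Ci * phase X T L)%C).

Definition C_infty (Q : C -> Prop) : Prop :=
  exists r : R, forall z : C, r < Cmod z -> Q z.

Definition inside (z : C) : Prop := Cmod z < 1.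
Definition outside (z : C) : Prop := 1 < Cmod z.
Definition circle (z : C) : Prop := Cmod z = 1.

(* [V] is the continuous boundary value on the unit circle of [P] taken
   from the region [D]. *)
Definition boundary_value (D : C -> Prop) (P V : C -> M2) : Prop :=
  forall z : C, circle z -> forall i j : nat, (i < 2)%nat -> (j < 2)%nat ->
    filterlim (fun w => entry (P w) i j) (within D (locally z))
              (locally (entry (V z) i j))
    /\ filterlim (fun w => entry (V w) i j) (within circle (locally z))
              (locally (entry (V z) i j)).

(* The problem constrains [P] only off the unit circle: the boundary values
   are separate functions, and [P z] is arbitrary when [Cmod z = 1]. *)
Definition RHP (X T : R) (G : M2) (P : C -> M2) : Prop :=
  (forall z : C, Cmod z <> 1 ->
     forall i j : nat, (i < 2)%nat -> (j < 2)%nat ->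
     @ex_derive C_AbsRing C_NormedModule (fun w => entry (P w) i j) z)
  /\ (exists Pplus Pminus : C -> M2,
        boundary_value outside P Pplus
        /\ boundary_value inside P Pminus
        /\ forall L : C, circle L -> Pplus L = mul2 (Pminus L) (jump X T G L))
  /\ (forall i j : nat, (i < 2)%nat -> (j < 2)%nat ->
        filterlim (fun w => entry (P w) i j) C_infty
                  (locally (entry id2 i j))).

(* [epsilon] selects a solution. Two solutions agree off the unit circle, so
   the choice does not affect [Psi]. *)
Definition Psol (X T : R) (G : M2) : C -> M2 :=
  epsilon (inhabits (fun _ => id2)) (RHP X T G).

Definition Psi (X T : R) (G : M2) : C :=
  (2 * Ci *
   @iota C_CompleteNormedModule (fun l : C =>
     filterlim (fun L : C => L * entry (Psol X T G L) 0 1)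
               C_infty (locally l)))%C.

Lemma mat2_entries (M : M2) :
  M = mat2 (entry M 0 0) (entry M 0 1) (entry M 1 0) (entry M 1 1).
Proof.
destruct M as [[x [y u]] [[z [t v]] w]]; destruct u, v, w; reflexivity.
Qed.

Lemma mul2E (a b c d a' b' c' d' : C) :
  mul2 (mat2 a b c d) (mat2 a' b' c' d') =
  mat2 (a * a' + b * c')%C (a * b' + b * d')%C
       (c * a' + d * c')%C (c * b' + d * d')%C.
Proof.
rewrite (mat2_entries (mul2 _ _)).
unfold mul2, entry, Mmult.
change (RtoC 0) with (@zero C_Ring).
rewrite !coeff_mat_bij by lia.
simpl Init.Nat.pred.
rewrite !sum_Sn, !sum_O.
reflexivity.
Qed.

Lemma id2E : id2 = mat2 1 0 0 1.
Proof. reflexivity. Qed.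

Lemma det2E (a b c d : C) : det2 (mat2 a b c d) = (a * d - b * c)%C.
Proof. reflexivity. Qed.

Lemma inv2E (a b c d : C) :
  inv2 (mat2 a b c d) =
  mat2 (d / (a * d - b * c))%C (- b / (a * d - b * c))%C
       (- c / (a * d - b * c))%C (a / (a * d - b * c))%C.
Proof. reflexivity. Qed.

Lemma inv2_r (M : M2) : det2 M <> RtoC 0 -> mul2 M (inv2 M) = id2.
Proof.
rewrite (mat2_entries M); generalize (entry M 0 0), (entry M 0 1),
  (entry M 1 0), (entry M 1 1); intros a b c d H.
rewrite det2E in H; rewrite inv2E.
rewrite mul2E, id2E; f_equal; field; exact H.
Qed.

Lemma inv2_l (M : M2) : det2 M <> RtoC 0 -> mul2 (inv2 M) M = id2.
Proof.
rewrite (mat2_entries M); generalize (entry M 0 0), (entry M 0 1),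
  (entry M 1 0), (entry M 1 1); intros a b c d H.
rewrite det2E in H; rewrite inv2E.
rewrite mul2E, id2E; f_equal; field; exact H.
Qed.

Lemma Carg_polar (z : C) : z = (Cmod z * Cexp (Ci * Carg z))%C.
Proof.
destruct (Ceq_dec z 0) as [->|Hz].
  now rewrite Cmod_0, Cmult_0_l.
assert (Hp : 0 < Cmod z) by now apply Cmod_gt_0.
assert (Hm := Cmod2_alt z).
assert (Hb : -1 <= Re z / Cmod z <= 1).
  assert (H := re_le_Cmod z); apply Rabs_le_between in H.
  split; [apply Rmult_le_reg_r with (Cmod z) | apply Rmult_le_reg_r with (Cmod z)];
    trivial; field_simplify; lra.
assert (Hs : sqrt (1 - (Re z / Cmod z)²) = Rabs (Im z) / Cmod z).
  replace (1 - (Re z / Cmod z)²) with ((Im z / Cmod z)²).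
    now rewrite sqrt_Rsqr_abs, Rabs_div, (Rabs_pos_eq (Cmod z)) by lra.
  replace 1 with (Cmod z ^ 2 / Cmod z ^ 2) by (field; lra).
  rewrite Hm at 1; unfold Rsqr; field; lra.
assert (Hc : cos (Carg z) = Re z / Cmod z
             /\ sin (Carg z) = Im z / Cmod z).
  unfold Carg; destruct (Rle_dec 0 (Im z)) as [Hi|Hi].
    now rewrite cos_acos, sin_acos, Hs, Rabs_pos_eq.
  rewrite cos_neg, sin_neg, cos_acos, sin_acos, Hs, Rabs_left by lra.
  split; [reflexivity | field; lra].
destruct Hc as [Hc1 Hc2].
replace (Cexp (Ci * Carg z)) with (cos (Carg z), sin (Carg z)).
  rewrite Hc1, Hc2; destruct z as [x y].
  unfold Cmult, RtoC; simpl in *; f_equal; field; lra.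
unfold Cexp; simpl.
replace (0 * Carg z - 1 * 0) with 0 by ring.
replace (0 * 0 + 1 * Carg z) with (Carg z) by ring.
now rewrite exp_0, !Rmult_1_l.
Qed.

(* Main.v *)
Require Import Defs.
From Stdlib Require Import Reals Lra Lia ClassicalEpsilon.
From Coquelicot Require Import Coquelicot.
Open Scope R_scope.

(* At [X = T = 0] the jump [J(L)] is an entire function of [1 / L] that equals
   [G] at infinity, so [G^-1] inside and [G^-1 J(L)] outside solves the
   problem, and [Psi] is read off its expansion in [1 / L].  Conversely, given
   a solution [P], the function equal to [P] inside and [P J^-1] outside is
   continuous on the plane, holomorphic off the unit circle and tends to
   [G^-1] at infinity; it must be constant.  For this, let [F] be continuous,
   holomorphic off the circle and vanish at infinity.  Then the means of
   [z (F z - F z0) / (z - z0)] over circles [Cmod z = exp s] do not depend on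
   [s]: in the variable [log z] this is Goursat's theorem on rectangles, and
   the vertical lines where differentiability fails are crossed by continuity.
   Comparing [s -> -oo] with [s -> +oo] gives [F z0 = 0]. *)

(** * Limits and complex differentiability *)

(** [C] carries the product uniform structure, whose balls are squares; [locally_C] identifies its
    neighbourhoods with those of the modulus, in which every estimate below is made. *)
Lemma locally_Cmod (z : C) (Q : C -> Prop) :
  locally z Q <-> exists d, 0 < d /\ forall w, Cmod (w - z) < d -> Q w.
Proof.
split.
- intros H; apply locally_C in H; destruct H as [d Hd].
  exists d; split; [apply cond_pos | exact Hd].
- intros [d [Hd H]]; apply locally_C; exists (mkposreal d Hd); exact H.
Qed.

Lemma filterlim_Cmod {T} (F : (T -> Prop) -> Prop) {FF : Filter F}
    (f : T -> C) (l : C) :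
  filterlim f F (locally l) <-> forall e, 0 < e -> F (fun x => Cmod (f x - l) < e).
Proof.
split.
- intros H e He.
  apply (H (fun w => Cmod (w - l) < e)), locally_Cmod; exists e; auto.
- intros H Q HQ; apply locally_Cmod in HQ; destruct HQ as [d [Hd HQ]].
  unfold filtermap; generalize (H d Hd); apply filter_imp; auto.
Qed.

Section FilterlimC.
Context {T : Type} {F : (T -> Prop) -> Prop} {FF : Filter F}.

Lemma filterlim_Cplus (f g : T -> C) (a b : C) :
  filterlim f F (locally a) -> filterlim g F (locally b) ->
  filterlim (fun x => (f x + g x)%C) F (locally (a + b)%C).
Proof.
intros Hf Hg.
exact (filterlim_comp_2 _ _ _ Hf Hg (@filterlim_plus C_AbsRing C_NormedModule a b)).
Qed.

Lemma filterlim_Cmult (f g : T -> C) (a b : C) :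
  filterlim f F (locally a) -> filterlim g F (locally b) ->
  filterlim (fun x => (f x * g x)%C) F (locally (a * b)%C).
Proof.
intros Hf Hg.
refine (filterlim_comp_2 _ _ _ _ Hg (@filterlim_scal C_AbsRing C_NormedModule a b)).
(* The scalar in [filterlim_scal] ranges over the absolute ring [C_AbsRing], whose neighbourhoods
   must be converted to the product ones. *)
intros Q HQ; apply Hf, locally_C; exact HQ.
Qed.

Lemma filterlim_Copp (f : T -> C) (a : C) :
  filterlim f F (locally a) -> filterlim (fun x => (- f x)%C) F (locally (- a)%C).
Proof.
intros Hf.
exact (filterlim_comp _ _ _ _ _ _ _ _ Hf (@filterlim_opp C_AbsRing C_NormedModule a)).
Qed.

Lemma filterlim_Cminus (f g : T -> C) (a b : C) :
  filterlim f F (locally a) -> filterlim g F (locally b) ->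
  filterlim (fun x => (f x - g x)%C) F (locally (a - b)%C).
Proof. intros Hf Hg; now apply filterlim_Cplus, filterlim_Copp. Qed.

End FilterlimC.

(* Carathéodory's form of complex differentiability: the slope [s] is
   continuous at [z]. *)
Definition cdiff (f : C -> C) (z : C) : Prop :=
  exists s : C -> C, continuous s z /\ forall w, f w = (f z + (w - z) * s w)%C.

(** A slope valid only near [z] suffices: the difference quotient, completed by [s z] at [z],
    satisfies the equation everywhere and agrees with [s] near [z]. *)
Lemma cdiff_loc (f : C -> C) (z : C) (s : C -> C) :
  continuous s z -> locally z (fun w => f w = (f z + (w - z) * s w)%C) ->
  cdiff f z.
Proof.
intros Hs Hf.
exists (fun w => if Ceq_dec w z then s z else (f w - f z) / (w - z))%C.
assert (Hne : forall w, w <> z -> (w - z)%C <> RtoC 0).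
  intros w Hw H; apply Hw; replace w with (w - z + z)%C by ring.
  rewrite H; ring.
split.
- unfold continuous; destruct (Ceq_dec z z) as [_|n]; [|now elim n].
  refine (filterlim_ext_loc _ _ _ Hs).
  revert Hf; apply filter_imp; intros w Hw; destruct (Ceq_dec w z) as [->|Hn]; trivial.
  rewrite Hw; assert (H := Hne w Hn); symmetry.
  change ((f z + (w - z) * s w - f z) / (w - z) = s w)%C; field; exact H.
- intros w; destruct (Ceq_dec w z) as [->|Hn]; [ring | field; auto].
Qed.

Lemma cdiff_ext_loc (f g : C -> C) (z : C) :
  locally z (fun w => f w = g w) -> cdiff f z -> cdiff g z.
Proof.
intros H [s [Hs Hf]]; apply (cdiff_loc g z s Hs).
rewrite <- (locally_singleton _ _ H).
revert H; apply filter_imp; intros w <-; apply Hf.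
Qed.

Lemma cdiff_ex_derive (f : C -> C) (z : C) :
  cdiff f z <-> @ex_derive C_AbsRing C_NormedModule f z.
Proof.
split.
- intros [s [Hs Hf]]; exists (s z); split.
    exact (@is_linear_scal_l C_AbsRing C_NormedModule (s z)).
  intros x Hx e.
  (* Coquelicot asks for the estimate at every limit point of the filter [locally z]; the only one
     is [z]. *)
  apply (@is_filter_lim_locally_unique C_AbsRing (AbsRing_NormedModule C_AbsRing)) in Hx.
  subst x.
  assert (H := proj1 (filterlim_Cmod _ s (s z)) Hs e (cond_pos e)).
  apply locally_C in H.
  revert H; apply filter_imp; intros w Hw.
  change (Cmod (f w - f z - (w - z) * s z) <= e * Cmod (w - z)).
  replace (f w - f z - (w - z) * s z)%C with ((w - z) * (s w - s z))%C
    by (rewrite (Hf w); ring).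
  rewrite Cmod_mult, Rmult_comm.
  apply Rmult_le_compat_r; [apply Cmod_ge_0 | lra].
- intros [d [_ Hd]].
  specialize (Hd z (fun P H => H)).
  apply (cdiff_loc f z (fun w => if Ceq_dec w z then d else (f w - f z) / (w - z))%C).
    unfold continuous; destruct (Ceq_dec z z) as [_|n]; [|now elim n].
    apply (filterlim_Cmod _); intros e He.
    assert (He2 : 0 < e / 2) by lra.
    generalize (Hd (mkposreal _ He2)); intros H; apply locally_C in H.
    revert H; apply filter_imp; intros w Hw.
    destruct (Ceq_dec w z) as [->|Hn].
      replace (d - d)%C with (RtoC 0) by ring; now rewrite Cmod_0.
    change (Cmod (f w - f z - (w - z) * d) <= e / 2 * Cmod (w - z)) in Hw.
    assert (Hwz : (w - z)%C <> RtoC 0).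
      intros H; apply Hn; replace w with (w - z + z)%C by ring.
      rewrite H; ring.
    replace ((f w - f z) / (w - z) - d)%C
      with ((f w - f z - (w - z) * d) / (w - z))%C by (field; trivial).
    rewrite Cmod_div by trivial.
    apply Cmod_gt_0 in Hwz.
    apply Rmult_lt_reg_r with (Cmod (w - z)); trivial.
    unfold Rdiv at 1; rewrite Rmult_assoc, Rinv_l, Rmult_1_r by lra.
    nra.
  apply filter_forall; intros w; destruct (Ceq_dec w z) as [->|Hn]; [ring|].
  field; intros H; apply Hn; replace w with (w - z + z)%C by ring.
  rewrite H; ring.
Qed.

Lemma cdiff_continuous (f : C -> C) (z : C) : cdiff f z -> continuous f z.
Proof.
intros [s [Hs Hf]].
assert (H : filterlim (fun w => f z + (w - z) * s w)%C (locally z)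
              (locally (f z + (z - z) * s z)%C)).
  apply filterlim_Cplus; [apply filterlim_const|].
  apply filterlim_Cmult; [|exact Hs].
  apply filterlim_Cminus; [apply filterlim_id | apply filterlim_const].
replace (f z + (z - z) * s z)%C with (f z) in H by ring.
revert H; apply filterlim_ext; intros w; now rewrite <- Hf.
Qed.

Lemma cdiff_const (c z : C) : cdiff (fun _ => c) z.
Proof. exists (fun _ => RtoC 0); split; [apply continuous_const | intros; ring]. Qed.

Lemma cdiff_id (z : C) : cdiff (fun w => w) z.
Proof. exists (fun _ => RtoC 1); split; [apply continuous_const | intros; ring]. Qed.

Lemma cdiff_plus (f g : C -> C) (z : C) :
  cdiff f z -> cdiff g z -> cdiff (fun w => (f w + g w)%C) z.
Proof.
intros [s [Hs Hf]] [t [Ht Hg]]; exists (fun w => s w + t w)%C; split.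
- now apply filterlim_Cplus.
- intros w; rewrite (Hf w), (Hg w); ring.
Qed.

Lemma cdiff_mult (f g : C -> C) (z : C) :
  cdiff f z -> cdiff g z -> cdiff (fun w => (f w * g w)%C) z.
Proof.
intros Df Dg; assert (Cg := cdiff_continuous g z Dg).
destruct Df as [s [Hs Hf]], Dg as [t [Ht Hg]].
exists (fun w => s w * g w + f z * t w)%C; split.
- apply filterlim_Cplus; apply filterlim_Cmult; trivial; apply filterlim_const.
- intros w; rewrite (Hf w); rewrite (Hg w); ring.
Qed.

Lemma cdiff_opp (f : C -> C) (z : C) : cdiff f z -> cdiff (fun w => (- f w)%C) z.
Proof.
intros [s [Hs Hf]]; exists (fun w => - s w)%C; split.
- now apply filterlim_Copp.
- intros w; rewrite (Hf w); ring.
Qed.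

Lemma cdiff_minus (f g : C -> C) (z : C) :
  cdiff f z -> cdiff g z -> cdiff (fun w => (f w - g w)%C) z.
Proof. intros Df Dg; now apply cdiff_plus, cdiff_opp. Qed.

Lemma cdiff_comp (f g : C -> C) (z : C) :
  cdiff g z -> cdiff f (g z) -> cdiff (fun w => f (g w)) z.
Proof.
intros Dg Df; assert (Cg := cdiff_continuous g z Dg).
destruct Df as [s [Hs Hf]], Dg as [t [Ht Hg]].
exists (fun w => t w * s (g w))%C; split.
- apply filterlim_Cmult; trivial; now apply filterlim_comp with (locally (g z)).
- intros w; rewrite (Hf (g w)); rewrite (Hg w) at 1; ring.
Qed.

Lemma Cminus_eq0 (w z : C) : (w - z)%C = RtoC 0 -> w = z.
Proof. intros H; replace w with (w - z + z)%C by ring; rewrite H; ring. Qed.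

Lemma Cmod_sub_le (w z : C) : Cmod z - Cmod w <= Cmod (w - z).
Proof.
assert (H := Cmod_triangle w (- (w - z))).
rewrite Cmod_opp in H; replace (w + - (w - z))%C with z in H by ring; lra.
Qed.

Lemma Cmod_sub_sym (w z : C) : Cmod (w - z) = Cmod (z - w).
Proof. rewrite <- Cmod_opp; f_equal; ring. Qed.

Lemma continuous_Cinv (z : C) : z <> RtoC 0 -> continuous Cinv z.
Proof.
intros Hz; apply (filterlim_Cmod _); intros e He.
assert (Hm := proj1 (Cmod_gt_0 z) Hz).
(* The first bound forces [Cmod w > Cmod z / 2]; with it, the second bounds
   [Cmod (w - z) / (Cmod z * Cmod w)] by [e]. *)
apply locally_Cmod; exists (Rmin (Cmod z / 2) (e * (Cmod z * (Cmod z / 2)))).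
split.
  apply Rmin_pos; [lra | apply Rmult_lt_0_compat; [lra | nra]].
intros w Hw.
assert (H1 := Rlt_le_trans _ _ _ Hw (Rmin_l _ _)).
assert (H2 := Rlt_le_trans _ _ _ Hw (Rmin_r _ _)).
assert (H3 := Cmod_sub_le w z).
assert (Hwn : w <> RtoC 0) by (apply Cmod_gt_0; lra).
replace (/ w - / z)%C with (- (w - z) / (z * w))%C by (field; auto).
rewrite Cmod_div, Cmod_opp, Cmod_mult by now apply Cmult_neq_0.
apply Rmult_lt_reg_r with (Cmod z * Cmod w); [nra|].
unfold Rdiv at 1; rewrite Rmult_assoc, Rinv_l, Rmult_1_r by nra.
apply Rlt_le_trans with (1 := H2); apply Rmult_le_compat_l; [lra|].
apply Rmult_le_compat_l; lra.
Qed.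

Lemma locally_neq (z c : C) : z <> c -> locally z (fun w => w <> c).
Proof.
intros H; apply locally_Cmod; exists (Cmod (z - c)); split.
- apply Cmod_gt_0; intros H0; now apply H, Cminus_eq0.
- intros w Hw ->; rewrite Cmod_sub_sym in Hw; lra.
Qed.

Lemma cdiff_inv (z : C) : z <> RtoC 0 -> cdiff Cinv z.
Proof.
intros Hz; apply (cdiff_loc Cinv z (fun w => - (/ z * / w))%C).
- apply filterlim_Copp, filterlim_Cmult;
    [apply filterlim_const | now apply continuous_Cinv].
- generalize (locally_neq z 0 Hz); apply filter_imp; intros w Hw; field; auto.
Qed.

(** * The complex exponential and its derivative *)

Lemma Cexp_plus (x y : C) : Cexp (x + y) = (Cexp x * Cexp y)%C.
Proof.
destruct x as [a b], y as [c d]; unfold Cexp, Cplus, Cmult; simpl.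
rewrite exp_plus, cos_plus, sin_plus; f_equal; ring.
Qed.

Lemma Cexp_0 : Cexp 0 = RtoC 1.
Proof. unfold Cexp; simpl; rewrite exp_0, cos_0, sin_0, Rmult_1_l, Rmult_0_r; reflexivity. Qed.

Lemma Cmod_Cexp (z : C) : Cmod (Cexp z) = exp (Re z).
Proof.
assert (H := sin2_cos2 (Im z)); unfold Rsqr in H.
apply Rsqr_inj; [apply Cmod_ge_0 | left; apply exp_pos |].
rewrite !Rsqr_pow2, Cmod2_alt; simpl.
transitivity (exp (Re z) * exp (Re z) * (sin (Im z) * sin (Im z) + cos (Im z) * cos (Im z)));
  [ring | rewrite H; ring].
Qed.

Lemma Cmod_le_sum (x y : R) : Cmod (x, y) <= Rabs x + Rabs y.
Proof.
replace ((x, y) : C) with (RtoC x + Ci * RtoC y)%C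
  by (unfold Cplus, Cmult; simpl; f_equal; ring).
eapply Rle_trans; [apply Cmod_triangle|].
rewrite Cmod_mult, Cmod_Ci, !Cmod_R; lra.
Qed.

Lemma Rabs_Re_le (z : C) : Rabs (Re z) <= Cmod z.
Proof. eapply Rle_trans; [apply Rmax_l | apply Rmax_Cmod]. Qed.

Lemma Rabs_Im_le (z : C) : Rabs (Im z) <= Cmod z.
Proof. eapply Rle_trans; [apply Rmax_r | apply Rmax_Cmod]. Qed.

Lemma first_order_bound (f : R -> R) (d : R) (e : R) :
  derivable_pt_lim f 0 d -> 0 < e ->
  exists r, 0 < r /\ forall x, Rabs x < r -> Rabs (f x - f 0 - d * x) <= e * Rabs x.
Proof.
intros Hf He; destruct (Hf e He) as [r Hr].
exists r; split; [apply cond_pos | intros x Hx].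
destruct (Req_dec x 0) as [->|Hn].
  replace (f 0 - f 0 - d * 0) with 0 by ring; rewrite Rabs_R0; lra.
specialize (Hr x Hn Hx); rewrite Rplus_0_l in Hr.
replace (f x - f 0 - d * x) with (((f x - f 0) / x - d) * x) by (field; trivial).
rewrite Rabs_mult; apply Rmult_le_compat_r; [apply Rabs_pos | lra].
Qed.

Lemma Cexp_first_order (e : R) :
  0 < e -> exists r, 0 < r /\
  forall h, Cmod h < r -> Cmod (Cexp h - 1 - h) <= e * Cmod h.
Proof.
intros He.
(* With [m = Cmod h], the final estimate is [4 * e' * m + 4 * m * m]; the choices [e' <= e / 8] and
   [m < e / 8] make each half at most [e / 2 * m]. The bound [e' <= 1] gives
   [Rabs (sin y) <= 2 * m]. *)
set (e' := Rmin (e / 8) 1).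
assert (He' : 0 < e') by (apply Rmin_pos; lra).
assert (He1 : e' <= 1) by apply Rmin_r.
assert (He8 : e' <= e / 8) by apply Rmin_l.
destruct (first_order_bound exp (exp 0) e' (derivable_pt_lim_exp 0) He') as [r1 [Hr1 H1]].
destruct (first_order_bound cos (- sin 0) e' (derivable_pt_lim_cos 0) He') as [r2 [Hr2 H2]].
destruct (first_order_bound sin (cos 0) e' (derivable_pt_lim_sin 0) He') as [r3 [Hr3 H3]].
rewrite exp_0 in H1; rewrite sin_0, cos_0 in H2; rewrite sin_0, cos_0 in H3.
exists (Rmin (Rmin r1 r2) (Rmin r3 (Rmin 1 (e / 8)))).
split; [repeat apply Rmin_pos; lra|].
intros h Hh.
assert (Hm : Cmod h < r1 /\ Cmod h < r2 /\ Cmod h < r3 /\ Cmod h < 1 /\ Cmod h < e / 8).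
  revert Hh; unfold Rmin; repeat destruct Rle_dec; intros; lra.
destruct Hm as [M1 [M2 [M3 [M4 M5]]]].
assert (Rx := Rabs_Re_le h); assert (Ry := Rabs_Im_le h).
destruct h as [x y]; simpl in Rx, Ry.
set (m := Cmod (x, y)) in *.
specialize (H1 x ltac:(lra)); specialize (H2 y ltac:(lra)); specialize (H3 y ltac:(lra)).
replace (Cexp (x, y) - 1 - (x, y))%C
  with ((exp x * cos y - 1 - x, exp x * sin y - y) : C)
  by (unfold Cexp, Cminus, Cplus, Copp, RtoC; simpl; f_equal; ring).
eapply Rle_trans; [apply Cmod_le_sum|].
(* [p], [q] and [t] are the first-order remainders of [exp], [cos] and [sin]; the real and imaginary
   parts of the complex remainder are expressed through them. *)
set (p := exp x - 1 - 1 * x) in *; set (q := cos y - 1 - - 0 * y) in *.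
set (t := sin y - 0 - 1 * y) in *.
assert (Hcos : Rabs (cos y) <= 1) by (apply Rabs_le, COS_bound).
assert (Hsin : Rabs (sin y) <= 2 * m).
  replace (sin y) with (t + y) by (unfold t; ring).
  eapply Rle_trans; [apply Rabs_triang|].
  assert (e' * Rabs y <= Rabs y) by (generalize (Rabs_pos y); nra). lra.
replace (exp x * cos y - 1 - x) with (p * cos y + (1 + x) * q) by (unfold p, q; ring).
replace (exp x * sin y - y) with ((p + x) * sin y + t) by (unfold p, t; ring).
assert (Hm0 : 0 <= m) by apply Cmod_ge_0.
assert (Hp : Rabs p <= e' * m) by nra.
assert (Hq : Rabs q <= e' * m) by nra.
assert (Ht : Rabs t <= e' * m) by nra.
assert (A1 : Rabs (p * cos y + (1 + x) * q) <= e' * m + 2 * (e' * m)).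
  eapply Rle_trans; [apply Rabs_triang|]; rewrite !Rabs_mult.
  assert (Rabs (1 + x) <= 2).
    eapply Rle_trans; [apply Rabs_triang|]; rewrite Rabs_R1; lra.
  apply Rplus_le_compat.
    rewrite <- (Rmult_1_r (e' * m)); apply Rmult_le_compat; auto using Rabs_pos.
  apply Rmult_le_compat; auto using Rabs_pos.
assert (A2 : Rabs ((p + x) * sin y + t) <= 2 * m * (2 * m) + e' * m).
  eapply Rle_trans; [apply Rabs_triang|]; rewrite !Rabs_mult.
  apply Rplus_le_compat; trivial.
  apply Rmult_le_compat; auto using Rabs_pos.
  eapply Rle_trans; [apply Rabs_triang|].
  nra.
assert (m * m <= e / 8 * m) by nra.
assert (e' * m <= e / 8 * m) by nra.
lra.
Qed.

(** The slope at 0 serves twice: for the derivative of [Cexp], and for the coefficient of [1 / L] in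
    the solution at infinity. *)
Lemma Cexp_slope : exists s : C -> C,
  continuous s (RtoC 0) /\ s (RtoC 0) = RtoC 1 /\
  forall h, Cexp h = (1 + h * s h)%C.
Proof.
exists (fun h => if Ceq_dec h 0 then RtoC 1 else (Cexp h - 1) / h)%C.
split; [|split].
- unfold continuous; destruct (Ceq_dec 0 0) as [_|n]; [|now elim n].
  apply (filterlim_Cmod _); intros e He.
  destruct (Cexp_first_order (e / 2)) as [r [Hr H]]; [lra|].
  apply locally_Cmod; exists r; split; trivial; intros h Hh.
  replace (h - 0)%C with h in Hh by ring.
  destruct (Ceq_dec h 0) as [_|Hn].
    replace (1 - 1)%C with (RtoC 0) by ring; now rewrite Cmod_0.
  replace ((Cexp h - 1) / h - 1)%C with ((Cexp h - 1 - h) / h)%C by (field; trivial).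
  specialize (H h Hh).
  rewrite Cmod_div by trivial; apply Cmod_gt_0 in Hn.
  apply Rmult_lt_reg_r with (Cmod h); trivial.
  unfold Rdiv at 1; rewrite Rmult_assoc, Rinv_l, Rmult_1_r by lra.
  nra.
- destruct (Ceq_dec 0 0) as [_|n]; [reflexivity | now elim n].
- intros h; destruct (Ceq_dec h 0) as [->|Hn]; [rewrite Cexp_0; ring | field; trivial].
Qed.

(** The functional equation carries the slope at 0 to every point. *)
Lemma cdiff_Cexp (z : C) : cdiff Cexp z.
Proof.
apply cdiff_ext_loc with (fun w => Cexp z * Cexp (w - z))%C.
- apply filter_forall; intros w; rewrite <- Cexp_plus; f_equal; ring.
- apply cdiff_mult; [apply cdiff_const|].
  apply cdiff_comp.
    apply cdiff_minus; [apply cdiff_id | apply cdiff_const].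
  replace (z - z)%C with (RtoC 0) by ring.
  destruct Cexp_slope as [s [Hs [_ H]]]; exists s; split; trivial.
  intros h; rewrite Cexp_0, (H h); ring.
Qed.

(** * Goursat's theorem for rectangles *)

(** [C] is taken here as a normed module over the reals, as the integral over a real variable
    requires. *)
Definition CRInt (f : R -> C) (a b : R) : C := @RInt C_R_CompleteNormedModule f a b.

Definition Rcont (f : R -> C) : Prop := forall x : R, continuous f x.

Lemma ex_CRInt (f : R -> C) (a b : R) :
  Rcont f -> @ex_RInt C_R_CompleteNormedModule f a b.
Proof. intros Hf; apply (@ex_RInt_continuous C_R_CompleteNormedModule); intros; apply Hf. Qed.

Lemma Rcont_minus (f g : R -> C) : Rcont f -> Rcont g -> Rcont (fun x => (f x - g x)%C).
Proof. intros Hf Hg x; apply filterlim_Cminus; [apply Hf | apply Hg]. Qed.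

Lemma Cmod_CRInt_le (f : R -> C) (a b M : R) :
  a <= b -> Rcont f -> (forall x, a <= x <= b -> Cmod (f x) <= M) ->
  Cmod (CRInt f a b) <= (b - a) * M.
Proof.
intros Hab Hf HM; rewrite Cmod_norm.
apply (@norm_RInt_le_const C_R_CompleteNormedModule f a b); trivial.
- intros x Hx; specialize (HM x Hx); now rewrite Cmod_norm in HM.
- apply RInt_correct; now apply ex_CRInt.
Qed.

Lemma CRInt_minus (f g : R -> C) (a b : R) :
  Rcont f -> Rcont g ->
  CRInt (fun x => (f x - g x)%C) a b = (CRInt f a b - CRInt g a b)%C.
Proof.
intros Hf Hg; apply (@RInt_minus C_R_CompleteNormedModule); now apply ex_CRInt.
Qed.

Lemma CRInt_const (c : C) (a b : R) : CRInt (fun _ => c) a b = ((b - a)%R * c)%C.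
Proof.
unfold CRInt; rewrite (@RInt_const C_R_CompleteNormedModule).
destruct c as [x y]; unfold scal; simpl; unfold prod_scal, Cmult; simpl.
unfold scal; simpl; unfold mult; simpl; f_equal; ring.
Qed.

Lemma CRInt_Chasles (f : R -> C) (a b c : R) :
  Rcont f -> CRInt f a c = (CRInt f a b + CRInt f b c)%C.
Proof.
intros Hf; symmetry; apply (@RInt_Chasles C_R_CompleteNormedModule); now apply ex_CRInt.
Qed.

Lemma CRInt_ext (f g : R -> C) (a b : R) :
  (forall x, f x = g x) -> CRInt f a b = CRInt g a b.
Proof. intros H; apply (@RInt_ext C_R_CompleteNormedModule); auto. Qed.

Lemma continuous_to_C (x : R) (f : R -> C) :
  continuous f x <->
  forall e, 0 < e -> exists d, 0 < d /\ forall y, Rabs (y - x) < d -> Cmod (f y - f x) < e.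
Proof.
split.
- intros H e He; destruct (proj1 (filterlim_Cmod _ f (f x)) H e He) as [d Hd].
  exists d; split; [apply cond_pos | exact Hd].
- intros H; apply (filterlim_Cmod _); intros e He; destruct (H e He) as [d [Hd K]].
  exists (mkposreal d Hd); exact K.
Qed.

Lemma Cmod_pair_minus (x y u v : R) :
  Cmod ((x, y) - (u, v))%C <= Rabs (x - u) + Rabs (y - v).
Proof. exact (Cmod_le_sum (x - u) (y - v)). Qed.

Section Rectangle.
Context (h : C -> C) (hcont : forall z : C, continuous h z).

Lemma Rcont_vert (x : R) : Rcont (fun y => h (x, y)).
Proof.
intros y; apply continuous_to_C; intros e He.
destruct (proj1 (locally_Cmod _ _) (proj1 (filterlim_Cmod _ h _) (hcont (x, y)) e He))
  as [d [Hd H]].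
exists d; split; trivial; intros y' Hy; apply H.
eapply Rle_lt_trans; [apply Cmod_pair_minus|].
replace (x - x) with 0 by ring; rewrite Rabs_R0; lra.
Qed.

Lemma Rcont_horiz (y : R) : Rcont (fun x => h (x, y)).
Proof.
intros x; apply continuous_to_C; intros e He.
destruct (proj1 (locally_Cmod _ _) (proj1 (filterlim_Cmod _ h _) (hcont (x, y)) e He))
  as [d [Hd H]].
exists d; split; trivial; intros x' Hx; apply H.
eapply Rle_lt_trans; [apply Cmod_pair_minus|].
replace (y - y) with 0 by ring; rewrite Rabs_R0; lra.
Qed.

(* The integral of [h] along the counterclockwise boundary of [[a, b] x [c, d]]. *)
Definition rectint (a b c d : R) : C :=
  (CRInt (fun x => (h (x, c) - h (x, d))%C) a b
   + Ci * CRInt (fun y => (h (b, y) - h (a, y))%C) c d)%C.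

Lemma rectint_split_x (a m b c d : R) :
  rectint a b c d = (rectint a m c d + rectint m b c d)%C.
Proof.
unfold rectint.
rewrite (CRInt_Chasles _ a m b) by (apply Rcont_minus; apply Rcont_horiz).
rewrite !(CRInt_minus (fun y => h (_, y))) by apply Rcont_vert; ring.
Qed.

Lemma rectint_split_y (a b c m d : R) :
  rectint a b c d = (rectint a b c m + rectint a b m d)%C.
Proof.
unfold rectint.
rewrite (CRInt_Chasles _ c m d) by (apply Rcont_minus; apply Rcont_vert).
rewrite !(CRInt_minus (fun x => h (x, _))) by apply Rcont_horiz; ring.
Qed.

Lemma CRInt_diff_bound (f : R -> C) (a b M : R) (k : C) :
  a <= b -> Rcont f -> (forall x, a <= x <= b -> Cmod (f x - k) <= M) ->
  Cmod (CRInt f a b - (b - a)%R * k) <= (b - a) * M.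
Proof.
intros Hab Hf HM; rewrite <- CRInt_const, <- CRInt_minus; trivial.
- apply Cmod_CRInt_le; trivial; apply Rcont_minus; trivial; intros x; apply continuous_const.
- intros x; apply continuous_const.
Qed.

(* The affine part of [h] at [z] integrates to zero. *)
Lemma rectint_small (z : C) (e : R) :
  cdiff h z -> 0 < e -> exists r, 0 < r /\
  forall a b c d, a <= Re z <= b -> c <= Im z <= d -> (b - a) + (d - c) < r ->
  Cmod (rectint a b c d) <= e * ((b - a) + (d - c)) ^ 2.
Proof.
intros [s [Hs Hh]] He.
assert (He2 : 0 < e / 2) by lra.
destruct (proj1 (locally_Cmod _ _) (proj1 (filterlim_Cmod _ s _) Hs (e / 2) He2))
  as [r [Hr H]].
exists r; split; trivial; intros a b c d Hab Hcd Hsmall.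
set (D := b - a + (d - c)) in *.
assert (Hrem : forall x y, a <= x <= b -> c <= y <= d ->
  Cmod (h (x, y) - h z - ((x, y) - z) * s z) <= e / 2 * D).
  intros x y Hx Hy; rewrite (Hh (x, y)).
  replace (h z + ((x, y) - z) * s (x, y) - h z - ((x, y) - z) * s z)%C
    with ((s (x, y) - s z) * ((x, y) - z))%C by ring.
  assert (Hd : Cmod ((x, y) - z) <= D).
    destruct z as [u v]; simpl in *.
    eapply Rle_trans; [apply Cmod_pair_minus|].
    unfold D; apply Rplus_le_compat; apply Rabs_le; lra.
  rewrite Cmod_mult; apply Rmult_le_compat; auto using Cmod_ge_0.
  left; apply H; lra.
assert (Hpair : forall x y x' y', a <= x <= b -> c <= y <= d ->
  a <= x' <= b -> c <= y' <= d ->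
  Cmod (h (x, y) - h (x', y') - ((x - x')%R + Ci * (y - y')%R) * s z) <= e * D).
  intros x y x' y' Hx Hy Hx' Hy'.
  replace (h (x, y) - h (x', y') - ((x - x')%R + Ci * (y - y')%R) * s z)%C
    with ((h (x, y) - h z - ((x, y) - z) * s z)
          + - (h (x', y') - h z - ((x', y') - z) * s z))%C.
  2:{ replace ((x - x')%R + Ci * (y - y')%R)%C with ((x, y) - (x', y'))%C; [ring|].
      unfold Cminus, Cplus, Cmult, Copp; simpl; f_equal; ring. }
  eapply Rle_trans; [apply Cmod_triangle|]; rewrite Cmod_opp.
  generalize (Hrem x y Hx Hy) (Hrem x' y' Hx' Hy'); lra.
unfold rectint.
(* Along each pair of opposite sides the affine part contributes a constant. The two subtracted
   terms are multiples of [s z] by [(b - a) * Ci * (c - d)] and [Ci * (d - c) * (b - a)], which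
   cancel. *)
replace (CRInt (fun x => h (x, c) - h (x, d)) a b
         + Ci * CRInt (fun y => h (b, y) - h (a, y)) c d)%C
  with ((CRInt (fun x => h (x, c) - h (x, d)) a b
          - (b - a)%R * (((0)%R + Ci * (c - d)%R) * s z))
        + Ci * (CRInt (fun y => h (b, y) - h (a, y)) c d
          - (d - c)%R * (((b - a)%R + Ci * (0)%R) * s z)))%C.
2:{ rewrite !RtoC_minus; ring. }
eapply Rle_trans; [apply Cmod_triangle|]; rewrite Cmod_mult, Cmod_Ci, Rmult_1_l.
apply Rle_trans with ((b - a) * (e * D) + (d - c) * (e * D)).
2:{ unfold D; apply Req_le; ring. }
apply Rplus_le_compat.
- apply CRInt_diff_bound; [lra | apply Rcont_minus; apply Rcont_horiz |].
  intros x Hx; replace 0 with (x - x) by ring; apply Hpair; lra.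
- apply CRInt_diff_bound; [lra | apply Rcont_minus; apply Rcont_vert |].
  intros y Hy; replace 0 with (y - y) by ring; apply Hpair; lra.
Qed.

End Rectangle.

(** * Nested dyadic rectangles *)

Lemma dyadic_nested (x : nat -> R) (W : R) :
  0 <= W ->
  (forall n, x (S n) = x n \/ x (S n) = x n + W / 2 ^ S n) ->
  exists p, forall n, x n <= p <= x n + W / 2 ^ n.
Proof.
intros HW Hx.
assert (Hpos : forall n, 0 <= W / 2 ^ n).
  intros n; apply Rmult_le_pos; trivial; left; apply Rinv_0_lt_compat, pow_lt; lra.
assert (Hhalf : forall n, W / 2 ^ n = 2 * (W / 2 ^ S n)).
  intros n; simpl; field; apply pow_nonzero; lra.
assert (Hinc : forall n k, x n <= x (n + k)%nat).
  intros n k; induction k as [|k IH]; [rewrite Nat.add_0_r; lra|].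
  rewrite Nat.add_succ_r.
  generalize (Hx (n + k)%nat) (Hpos (S (n + k))%nat); intros [|]; lra.
assert (Hdec : forall n k, x (n + k)%nat + W / 2 ^ (n + k) <= x n + W / 2 ^ n).
  intros n k; induction k as [|k IH]; [rewrite Nat.add_0_r; lra|].
  rewrite Nat.add_succ_r.
  generalize (Hx (n + k)%nat) (Hpos (S (n + k))%nat) (Hhalf (n + k)%nat); intros [|]; lra.
assert (Hle : forall n m, x n <= x m + W / 2 ^ m).
  intros n m; destruct (Nat.le_ge_cases n m) as [Hnm|Hnm].
  - generalize (Hinc n (m - n)%nat) (Hpos m).
    replace (n + (m - n))%nat with m by lia; lra.
  - generalize (Hdec m (n - m)%nat) (Hpos n).
    replace (m + (n - m))%nat with n by lia; lra.
(* Every left endpoint lies below every right endpoint, so the supremum of the left endpoints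
   belongs to all the intervals. *)
destruct (completeness (fun r => exists n, r = x n)) as [p [Hub Hlub]].
- exists (x 0%nat + W / 2 ^ 0); intros r [n ->]; apply Hle.
- exists (x 0%nat); now exists 0%nat.
- exists p; intros n; split.
    apply Hub; now exists n.
  apply Hlub; intros r [m ->]; apply Hle.
Qed.

(** A point [p] stands for the rectangle with lower left corner [p] and sides [W / 2 ^ n] and
    [H / 2 ^ n]. Choosing a bad quarter at each stage gives nested rectangles, and [dyadic_nested]
    in each coordinate gives a common point. *)
Lemma quadrisection (bad : nat -> R * R -> Prop) (p0 : R * R) (W H : R) :
  0 <= W -> 0 <= H -> bad 0%nat p0 ->
  (forall n p, bad n p -> exists q, bad (S n) q /\
     (fst q = fst p \/ fst q = fst p + W / 2 ^ S n) /\
     (snd q = snd p \/ snd q = snd p + H / 2 ^ S n)) ->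
  exists x y, forall n, exists p, bad n p /\
    fst p <= x <= fst p + W / 2 ^ n /\ snd p <= y <= snd p + H / 2 ^ n.
Proof.
intros HW HH Hbad0 Hstep.
set (next n (p : {p | bad n p}) :=
  constructive_indefinite_description _ (Hstep n (proj1_sig p) (proj2_sig p))).
(* Each corner carries its proof of [bad], without which the next quarter could not be chosen. *)
set (u := fix u n : {p | bad n p} :=
  match n with
  | O => exist _ p0 Hbad0
  | S m => exist _ (proj1_sig (next m (u m))) (proj1 (proj2_sig (next m (u m))))
  end).
destruct (dyadic_nested (fun n => fst (proj1_sig (u n))) W HW) as [x Hx].
  intros n; exact (proj1 (proj2 (proj2_sig (next n (u n))))).
destruct (dyadic_nested (fun n => snd (proj1_sig (u n))) H HH) as [y Hy].
  intros n; exact (proj2 (proj2 (proj2_sig (next n (u n))))).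
exists x, y; intros n; exists (proj1_sig (u n)); split; [exact (proj2_sig (u n)) | auto].
Qed.

Lemma pow2_inv_small (K e : R) : 0 < e -> exists n, K / 2 ^ n < e.
Proof.
intros He.
destruct (Pow_x_infinity 2 ltac:(rewrite Rabs_pos_eq; lra) (Rabs K / e + 1)) as [n Hn].
exists n; specialize (Hn n (le_n n)).
assert (Hp : 0 < 2 ^ n) by (apply pow_lt; lra).
rewrite Rabs_pos_eq in Hn by lra.
apply Rmult_lt_reg_r with (2 ^ n); trivial.
unfold Rdiv; rewrite Rmult_assoc, Rinv_l, Rmult_1_r by lra.
apply Rle_lt_trans with (1 := Rle_abs K).
apply Rmult_lt_reg_l with (/ e); [now apply Rinv_0_lt_compat|].
rewrite <- Rmult_assoc, Rinv_l, Rmult_1_l by lra.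
unfold Rdiv in Hn; lra.
Qed.

(* Goursat: quadrisecting a rectangle with nonzero integral yields a point
   near which [rectint_small] fails. *)
Lemma rectint_zero (h : C -> C) (a b c d : R) :
  (forall z : C, continuous h z) -> a <= b -> c <= d ->
  (forall x y, a <= x <= b -> c <= y <= d -> cdiff h (x, y)) ->
  rectint h a b c d = RtoC 0.
Proof.
intros hcont Hab Hcd hdiff.
destruct (Ceq_dec (rectint h a b c d) 0) as [E|N]; trivial; exfalso.
set (K := Cmod (rectint h a b c d)).
assert (HK : 0 < K) by now apply Cmod_gt_0.
set (W := b - a); set (H := d - c).
assert (Hpow : forall n, 0 < 2 ^ n) by (intros; apply pow_lt; lra).
assert (Hhalf : forall V n, V / 2 ^ n = 2 * (V / 2 ^ S n)).
  intros V n; simpl; field; apply Rgt_not_eq, Hpow.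
assert (Hpos : forall V n, 0 <= V -> 0 <= V / 2 ^ n).
  intros V n HV; apply Rmult_le_pos; trivial; left; apply Rinv_0_lt_compat, Hpow.
(* The lower bound [K / 4 ^ n] passes to a quarter: of four integrals whose sum has modulus at least
   [4 * L], one has modulus at least [L]. *)
set (bad n (p : R * R) :=
  a <= fst p /\ fst p + W / 2 ^ n <= b /\ c <= snd p /\ snd p + H / 2 ^ n <= d /\
  K / (2 ^ n) ^ 2 <= Cmod (rectint h (fst p) (fst p + W / 2 ^ n)
                                   (snd p) (snd p + H / 2 ^ n))).
destruct (quadrisection bad (a, c) W H) as [x [y Hxy]].
- unfold W; lra.
- unfold H; lra.
- unfold bad; simpl; replace (a + W / 1) with b by (unfold W; field).
  replace (c + H / 1) with d by (unfold H; field).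
  repeat split; try lra; fold K; apply Req_le; field.
- intros n [u v] [B1 [B2 [B3 [B4 B5]]]]; simpl fst in *; simpl snd in *.
  rewrite (Hhalf W n), (Hhalf H n) in *.
  assert (HW := Hpos W (S n) ltac:(unfold W; lra)).
  assert (HH := Hpos H (S n) ltac:(unfold H; lra)).
  replace (K / (2 ^ n) ^ 2) with (4 * (K / (2 ^ S n) ^ 2)) in B5
    by (simpl; field; apply Rgt_not_eq, Hpow).
  set (w := W / 2 ^ S n) in *; set (k := H / 2 ^ S n) in *.
  set (L := K / (2 ^ S n) ^ 2) in *.
  (* If no quarter is bad, the four integrals have moduli below [L], which contradicts [B5] once the
     rectangle is split. *)
  apply NNPP; intros Hno.
  assert (Hlt : forall u' v', (u' = u \/ u' = u + w) -> (v' = v \/ v' = v + k) ->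
    Cmod (rectint h u' (u' + w) v' (v' + k)) < L).
    intros u' v' Hu Hv; apply Rnot_le_lt; intros Hle; apply Hno.
    exists (u', v'); simpl fst; simpl snd; split; [|now split].
    unfold bad; simpl fst; simpl snd; fold w; fold k; fold L.
    destruct Hu, Hv; repeat split; trivial; lra.
  rewrite (rectint_split_x h hcont u (u + w)) in B5.
  rewrite (rectint_split_y h hcont _ _ v (v + k)) in B5.
  rewrite (rectint_split_y h hcont (u + w) _ v (v + k)) in B5.
  replace (u + 2 * w) with (u + w + w) in B5 by ring.
  replace (v + 2 * k) with (v + k + k) in B5 by ring.
  generalize (Hlt u v ltac:(auto) ltac:(auto)) (Hlt (u + w) v ltac:(auto) ltac:(auto))
    (Hlt u (v + k) ltac:(auto) ltac:(auto)) (Hlt (u + w) (v + k) ltac:(auto) ltac:(auto)).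
  revert B5.
  generalize (rectint h u (u + w) v (v + k)) (rectint h u (u + w) (v + k) (v + k + k))
    (rectint h (u + w) (u + w + w) v (v + k))
    (rectint h (u + w) (u + w + w) (v + k) (v + k + k)); intros r1 r2 r3 r4.
  generalize (Cmod_triangle (r1 + r2) (r3 + r4)) (Cmod_triangle r1 r2)
    (Cmod_triangle r3 r4); lra.
- assert (Hin : a <= x <= b /\ c <= y <= d).
    destruct (Hxy 0%nat) as [p [[B1 [B2 [B3 [B4 _]]]] [Hx Hy]]]; lra.
  (* Chosen so that [e * (W + H) ^ 2 < K]; the added 1 keeps the denominator positive for a
     degenerate rectangle. After scaling by [4 ^ n], the small-rectangle estimate would give
     [K <= e * (W + H) ^ 2]. *)
  set (e := K / (2 * (1 + (W + H)) ^ 2)).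
  assert (HWH : 0 <= W + H) by (unfold W, H; lra).
  assert (He : 0 < e).
    apply Rmult_lt_0_compat; trivial; apply Rinv_0_lt_compat; nra.
  destruct (rectint_small h hcont (x, y) e (hdiff x y (proj1 Hin) (proj2 Hin)) He)
    as [r [Hr Hsm]].
  destruct (pow2_inv_small (W + H) r Hr) as [n Hn].
  destruct (Hxy n) as [[u v] [[B1 [B2 [B3 [B4 B5]]]] [Hx Hy]]].
  simpl fst in *; simpl snd in *.
  specialize (Hsm u (u + W / 2 ^ n) v (v + H / 2 ^ n) Hx Hy).
  replace (u + W / 2 ^ n - u + (v + H / 2 ^ n - v)) with ((W + H) / 2 ^ n) in Hsm
    by (field; apply Rgt_not_eq, Hpow).
  specialize (Hsm Hn).
  assert (Hc := Rle_trans _ _ _ B5 Hsm).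
  assert (Hp2 : 0 < (2 ^ n) ^ 2) by (apply pow_lt, Hpow).
  apply (Rmult_le_compat_r ((2 ^ n) ^ 2)) in Hc; [|lra].
  replace (K / (2 ^ n) ^ 2 * (2 ^ n) ^ 2) with K in Hc by (field; apply Rgt_not_eq, Hpow).
  replace (e * ((W + H) / 2 ^ n) ^ 2 * (2 ^ n) ^ 2) with (e * (W + H) ^ 2) in Hc
    by (field; apply Rgt_not_eq, Hpow).
  assert (Hek : e * (2 * (1 + (W + H)) ^ 2) = K) by (unfold e; field; nra).
  nra.
Qed.

(** * Circle means and vanishing at infinity *)

(** Not normalised: for [h z = g (Cexp z)] this is [2 * PI] times the mean of [g] over the circle of
    radius [exp s]. *)
Definition vmean (h : C -> C) (s : R) : C := CRInt (fun t => h (s, t)) 0 (2 * PI).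

Lemma two_PI_pos : 0 < 2 * PI.
Proof. generalize PI_RGT_0; lra. Qed.

Lemma vmean_near (h : C -> C) (s e : R) (k : C) :
  (forall z : C, continuous h z) ->
  (forall t, Cmod (h (s, t) - k) <= e) -> Cmod (vmean h s - (2 * PI)%R * k) <= 2 * PI * e.
Proof.
intros hcont H.
generalize (CRInt_diff_bound (fun t => h (s, t)) 0 (2 * PI) e k).
rewrite Rminus_0_r; intros K; apply K; auto.
- left; exact two_PI_pos.
- now apply Rcont_vert.
Qed.

(** Compactness of the segment of integration makes the continuity of [h] across the line uniform in
    [t]. *)
Lemma vmean_continuous (h : C -> C) (s : R) :
  (forall z : C, continuous h z) -> continuous (vmean h) s.
Proof.
intros hcont; apply continuous_to_C; intros e He.
assert (H2pi := two_PI_pos).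
set (e' := e / (2 * (2 * PI))).
assert (He' : 0 < e') by (apply Rdiv_lt_0_compat; lra).
(* The factor 2 leaves room for two displacements: from [s] to [s'] and from [t] to a centre [t0],
   each less than [delta t0]. *)
assert (Hloc : forall t, exists d : posreal, forall w, Cmod (w - (s, t)) < 2 * d ->
  Cmod (h w - h (s, t)) < e' / 2).
  intros t.
  destruct (proj1 (locally_Cmod _ _)
    (proj1 (filterlim_Cmod _ h _) (hcont (s, t)) (e' / 2) ltac:(lra))) as [d [Hd H]].
  exists (mkposreal (d / 2) ltac:(lra)); intros w Hw; apply H; simpl in Hw; lra.
set (delta t := proj1_sig (constructive_indefinite_description _ (Hloc t))).
assert (Hdelta : forall t w, Cmod (w - (s, t)) < 2 * delta t -> Cmod (h w - h (s, t)) < e' / 2).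
  intros t; exact (proj2_sig (constructive_indefinite_description _ (Hloc t))).
destruct (compactness_value_1d 0 (2 * PI) delta) as [d Hd].
exists d; split; [apply cond_pos | intros s' Hs'].
unfold vmean; rewrite <- CRInt_minus by now apply Rcont_vert.
apply Rle_lt_trans with ((2 * PI - 0) * e').
2:{ unfold e'; replace ((2 * PI - 0) * (e / (2 * (2 * PI)))) with (e / 2) by (field; lra); lra. }
apply Cmod_CRInt_le; [lra | apply Rcont_minus; now apply Rcont_vert |].
(* [compactness_value_1d] yields the centre [t0] only under a double negation, so the bound is
   proved by contradiction. *)
intros t Ht; apply Rnot_lt_le; intros Hlt; apply (Hd t Ht); intros [t0 [_ [H1 H2]]].
revert Hlt; apply Rle_not_lt.
replace (h (s', t) - h (s, t))%C
  with ((h (s', t) - h (s, t0)) + - (h (s, t) - h (s, t0)))%C by ring.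
eapply Rle_trans; [apply Cmod_triangle|]; rewrite Cmod_opp.
assert (A1 : Cmod (h (s', t) - h (s, t0)) < e' / 2).
  apply Hdelta; eapply Rle_lt_trans; [apply Cmod_pair_minus|]; lra.
assert (A2 : Cmod (h (s, t) - h (s, t0)) < e' / 2).
  apply Hdelta; eapply Rle_lt_trans; [apply Cmod_pair_minus|].
  generalize (cond_pos (delta t0)); replace (s - s) with 0 by ring; rewrite Rabs_R0; lra.
lra.
Qed.

Lemma Cmod_small_0 (z : C) : (forall e, 0 < e -> Cmod z <= e) -> z = RtoC 0.
Proof.
intros H; destruct (Ceq_dec z 0) as [E|N]; trivial.
apply Cmod_gt_0 in N; generalize (H (Cmod z / 2) ltac:(lra)); lra.
Qed.

(* By periodicity the horizontal sides of a rectangle of height 2 pi cancel. *)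
Lemma vmean_strip (h : C -> C) (s t : R) :
  (forall z : C, continuous h z) -> (forall x, h (x, 2 * PI) = h (x, 0)) -> s < t ->
  (forall x y, s < x < t -> cdiff h (x, y)) -> vmean h s = vmean h t.
Proof.
intros hcont Hper Hst Hdiff.
assert (Hopen : forall u v, s < u -> u <= v -> v < t -> vmean h u = vmean h v).
  intros u v Hu Huv Hv; apply Cminus_eq0.
  assert (H := rectint_zero h u v 0 (2 * PI) hcont Huv (Rlt_le _ _ two_PI_pos)).
  specialize (H ltac:(intros; apply Hdiff; lra)); unfold rectint in H.
  rewrite (CRInt_ext _ (fun _ => RtoC 0)) in H by (intros x; rewrite Hper; ring).
  rewrite CRInt_const, CRInt_minus in H by now apply Rcont_vert.
  fold (vmean h u) in H; fold (vmean h v) in H.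
  replace (vmean h u - vmean h v)%C with
    (Ci * ((v - u)%R * 0 + Ci * (vmean h v - vmean h u)))%C.
    rewrite H; ring.
  transitivity ((Ci * Ci) * (vmean h v - vmean h u))%C; [ring|].
  replace (Ci * Ci)%C with (- (1))%C; [ring|].
  unfold Ci, Cmult, Copp, RtoC; simpl; f_equal; ring.
(* [Hopen] covers only the open strip; its two edges are reached by continuity of [vmean]. *)
apply Cminus_eq0, Cmod_small_0; intros e He.
destruct (proj1 (continuous_to_C _ _) (vmean_continuous h s hcont) (e / 2) ltac:(lra))
  as [d1 [Hd1 H1]].
destruct (proj1 (continuous_to_C _ _) (vmean_continuous h t hcont) (e / 2) ltac:(lra))
  as [d2 [Hd2 H2]].
(* Halving gives strict inequalities [k1 < d1], [k2 < d2] and ensures [s + k1 <= t - k2]. *)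
set (k1 := Rmin d1 (t - s) / 2); set (k2 := Rmin d2 (t - s) / 2).
assert (Hk1 : 0 < k1 < d1 /\ k1 <= (t - s) / 2).
  unfold k1, Rmin; destruct Rle_dec; lra.
assert (Hk2 : 0 < k2 < d2 /\ k2 <= (t - s) / 2).
  unfold k2, Rmin; destruct Rle_dec; lra.
specialize (H1 (s + k1) ltac:(replace (s + k1 - s) with k1 by ring; rewrite Rabs_pos_eq; lra)).
specialize (H2 (t - k2)
  ltac:(replace (t - k2 - t) with (- k2) by ring; rewrite Rabs_Ropp, Rabs_pos_eq; lra)).
rewrite (Hopen (s + k1) (t - k2)) in H1 by lra.
replace (vmean h s - vmean h t)%C
  with (- (vmean h (t - k2) - vmean h s) + (vmean h (t - k2) - vmean h t))%C by ring.
eapply Rle_trans; [apply Cmod_triangle|]; rewrite Cmod_opp; lra.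
Qed.

Lemma exp_small (e : R) : 0 < e -> forall s, s < ln e -> exp s < e.
Proof. intros He s Hs; rewrite <- (exp_ln e He); now apply exp_increasing. Qed.

Lemma exp_large (r : R) : 0 < r -> forall s, ln r < s -> r < exp s.
Proof. intros Hr s Hs; rewrite <- (exp_ln r Hr) at 1; now apply exp_increasing. Qed.

(* The mean of [g] over the circle of radius [exp s] does not depend on [s];
   compare small and large radii. *)
Lemma value_at_0_eq_limit (g : C -> C) (r1 r2 : R) (l : C) :
  0 < r1 < r2 -> (forall z : C, continuous g z) ->
  (forall z, Cmod z <> r1 -> Cmod z <> r2 -> cdiff g z) ->
  filterlim g C_infty (locally l) -> g (RtoC 0) = l.
Proof.
intros Hr gcont gdiff Hlim.
set (h z := g (Cexp z)).
assert (hcont : forall z : C, continuous h z).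
  intros z; apply (filterlim_comp _ _ _ Cexp g _ (locally (Cexp z))); [|apply gcont].
  apply cdiff_continuous, cdiff_Cexp.
assert (Hper : forall x, h (x, 2 * PI) = h (x, 0)).
  intros x; unfold h, Cexp; simpl; now rewrite cos_2PI, sin_2PI, cos_0, sin_0.
assert (Hdiff : forall x y, x <> ln r1 -> x <> ln r2 -> cdiff h (x, y)).
  intros x y H1 H2; apply (cdiff_comp g Cexp); [apply cdiff_Cexp|].
  apply gdiff; rewrite Cmod_Cexp; simpl; intros E; [apply H1 | apply H2];
    rewrite <- E; now rewrite ln_exp.
assert (Hln := ln_increasing r1 r2 (proj1 Hr) (proj2 Hr)).
(* The exceptional circles become the vertical lines at [ln r1] and [ln r2], which bound three
   successive strips. *)
assert (Hconst : forall s t, s < ln r1 -> ln r2 < t -> vmean h s = vmean h t).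
  intros s t Hs Ht.
  transitivity (vmean h (ln r1)).
    apply vmean_strip; trivial; intros; apply Hdiff; lra.
  transitivity (vmean h (ln r2)); apply vmean_strip; trivial; intros; apply Hdiff; lra.
assert (H2pi := two_PI_pos).
apply Cminus_eq0, Cmod_small_0; intros e He.
destruct (proj1 (locally_Cmod _ _)
  (proj1 (filterlim_Cmod _ g _) (gcont (RtoC 0)) (e / 2) ltac:(lra))) as [d [Hd H0]].
assert (Hl : C_infty (fun z => Cmod (g z - l) < e / 2)).
  apply (Hlim (fun w => Cmod (w - l) < e / 2)), locally_Cmod; exists (e / 2); split; [lra | auto].
destruct Hl as [r Hinf].
(* The radius [exp s] is below [d] and [exp t] is above [r]. Since [r] may be nonpositive, the
   logarithm is taken of [Rabs r + 1]. *)
set (s := Rmin (ln d) (ln r1) - 1); set (t := Rmax (ln (Rabs r + 1)) (ln r2) + 1).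
assert (Hs : s < ln d /\ s < ln r1) by (unfold s, Rmin; destruct Rle_dec; lra).
assert (Ht : ln (Rabs r + 1) < t /\ ln r2 < t) by (unfold t, Rmax; destruct Rle_dec; lra).
assert (N0 : Cmod (vmean h s - (2 * PI)%R * g (RtoC 0)) <= 2 * PI * (e / 2)).
  apply vmean_near; trivial; intros y; left; apply H0.
  replace (Cexp (s, y) - 0)%C with (Cexp (s, y)) by ring.
  rewrite Cmod_Cexp; simpl; now apply exp_small.
assert (Nl : Cmod (vmean h t - (2 * PI)%R * l) <= 2 * PI * (e / 2)).
  apply vmean_near; trivial; intros y; left; apply Hinf.
  rewrite Cmod_Cexp; simpl.
  generalize (Rle_abs r) (Rabs_pos r); intros.
  apply Rlt_trans with (Rabs r + 1); [lra|]; apply exp_large; lra.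
rewrite (Hconst s t) in N0 by lra.
apply Rmult_le_reg_l with (2 * PI); trivial.
rewrite <- (Rabs_pos_eq (2 * PI)) at 1 by lra.
rewrite <- Cmod_R, <- Cmod_mult.
replace ((2 * PI)%R * (g (RtoC 0) - l))%C
  with (- (vmean h t - (2 * PI)%R * g (RtoC 0)) + (vmean h t - (2 * PI)%R * l))%C by ring.
eapply Rle_trans; [apply Cmod_triangle|]; rewrite Cmod_opp; lra.
Qed.

(** Properness makes limits at infinity unique, so that [iota] in [Psi] returns the limit
    computed. *)
Global Instance C_infty_filter : ProperFilter C_infty.
Proof.
split; [|split].
- intros Q [r H]; exists (RtoC (Rabs r + 1)); apply H.
  rewrite Cmod_R; generalize (Rle_abs r) (Rabs_pos r); intros.
  rewrite Rabs_pos_eq; lra.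
- now exists 0.
- intros P Q [r HP] [s HQ]; exists (Rmax r s); intros z Hz; split.
  + apply HP; generalize (Rmax_l r s); lra.
  + apply HQ; generalize (Rmax_r r s); lra.
- intros P Q HPQ [r HP]; exists r; auto.
Qed.

Lemma filterlim_Cinv_infty (c : C) :
  filterlim (fun z => / (z - c))%C C_infty (locally (RtoC 0)).
Proof.
apply (filterlim_Cmod _); intros e He; exists (Cmod c + / e); intros z Hz.
assert (Hi := Rinv_0_lt_compat e He).
assert (H : / e < Cmod (z - c)).
  generalize (Cmod_sub_le c z); rewrite Cmod_sub_sym; lra.
replace (/ (z - c) - 0)%C with (/ (z - c))%C by ring.
rewrite Cmod_inv by (apply Cmod_gt_0; lra).
rewrite <- (Rinv_inv e); apply Rinv_lt_contravar; [apply Rmult_lt_0_compat; lra | trivial].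
Qed.

(** Let [s] be the slope of [F] at [z0]. The function [z * s z], equal to [F z - F z0 + z0 * s z],
    is 0 at the origin and tends to [- F z0] at infinity; [value_at_0_eq_limit] equates the two. *)
Lemma zero_of_vanishing_at_infty (F : C -> C) (r : R) (z0 : C) :
  0 < r -> (forall z : C, continuous F z) ->
  (forall z, Cmod z <> r -> cdiff F z) ->
  filterlim F C_infty (locally (RtoC 0)) -> r < Cmod z0 -> F z0 = RtoC 0.
Proof.
intros Hr Fcont Fdiff Flim Hz0.
destruct (Fdiff z0 ltac:(lra)) as [s [Hs HF]].
assert (Hquot : forall w, w <> z0 -> s w = ((F w - F z0) * / (w - z0))%C).
  intros w Hw; rewrite (HF w); field; intros E; now apply Hw, Cminus_eq0.
assert (Hloc : forall z, z <> z0 ->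
          locally z (fun w => ((F w - F z0) * / (w - z0))%C = s w)).
  intros z Hz; generalize (locally_neq z z0 Hz); apply filter_imp.
  intros w Hw; symmetry; auto.
assert (Sdiff : forall z, Cmod z <> r -> z <> z0 -> cdiff s z).
  intros z Hzr Hz; apply (cdiff_ext_loc _ _ _ (Hloc z Hz)).
  apply cdiff_mult; [apply cdiff_minus; [auto | apply cdiff_const]|].
  apply (cdiff_comp Cinv (fun w => w - z0)%C).
    apply cdiff_minus; [apply cdiff_id | apply cdiff_const].
  apply cdiff_inv; intros E; now apply Hz, Cminus_eq0.
assert (Scont : forall z : C, continuous s z).
  intros z; destruct (Ceq_dec z z0) as [->|Hz]; trivial.
  unfold continuous; rewrite (Hquot z Hz).
  apply (filterlim_ext_loc _ _ (Hloc z Hz)).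
  apply filterlim_Cmult.
    apply filterlim_Cminus; [apply Fcont | apply filterlim_const].
  apply (filterlim_comp _ _ _ (fun w => w - z0)%C Cinv _ (locally (z - z0)%C)).
    apply filterlim_Cminus; [apply filterlim_id | apply filterlim_const].
  apply continuous_Cinv; intros E; now apply Hz, Cminus_eq0.
assert (Slim : filterlim s C_infty (locally (RtoC 0))).
  replace (RtoC 0) with ((0 - F z0) * 0)%C by ring.
  apply (filterlim_ext_loc (fun w => (F w - F z0) * / (w - z0))%C).
    exists (Cmod z0); intros w Hw; symmetry; apply Hquot; intros ->; lra.
  apply filterlim_Cmult; [|apply filterlim_Cinv_infty].
  apply filterlim_Cminus; [exact Flim | apply filterlim_const].
assert (H : (0 * s 0 = - F z0)%C).
  (* The second exceptional circle passes through [z0], where [s] is only known to be continuous. *)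
  apply (value_at_0_eq_limit (fun z => z * s z)%C r (Cmod z0)); [lra | | |].
  - intros z; apply filterlim_Cmult; [apply filterlim_id | apply Scont].
  - intros z H1 H2; apply cdiff_mult; [apply cdiff_id|].
    apply Sdiff; trivial; now intros ->.
  - apply (filterlim_ext (fun z => F z - F z0 + z0 * s z)%C).
      intros z; rewrite (HF z); ring.
    replace (- F z0)%C with (0 - F z0 + z0 * 0)%C by ring.
    apply filterlim_Cplus.
      apply filterlim_Cminus; [exact Flim | apply filterlim_const].
    apply filterlim_Cmult; [apply filterlim_const | exact Slim].
replace (F z0) with (- - F z0)%C by ring; rewrite <- H; ring.
Qed.

(** * The Riemann-Hilbert problem at the origin *)

(* The jump matrix at [X = T = 0], as an entire function of [w = 1 / L]. *)
Definition jump0 (G : M2) (w : C) : M2 :=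
  mat2 (entry G 0 0) (entry G 0 1 * Cexp (- (4 * Ci) * w))%C
       (entry G 1 0 * Cexp (4 * Ci * w))%C (entry G 1 1).

(** The phase reduces to [2 / L]; conjugation by the diagonal exponentials fixes the diagonal of [G]
    and multiplies the off-diagonal entries by [Cexp] of [-4i / L] and [4i / L]. *)
Lemma jump_origin (G : M2) (L : C) : jump 0 0 G L = jump0 G (/ L).
Proof.
rewrite (mat2_entries G); generalize (entry G 0 0), (entry G 0 1),
  (entry G 1 0), (entry G 1 1); intros p q r s.
unfold jump, exp_sigma3, jump0; rewrite !mul2E.
change (entry (mat2 p q r s) 0 0) with p; change (entry (mat2 p q r s) 0 1) with q.
change (entry (mat2 p q r s) 1 0) with r; change (entry (mat2 p q r s) 1 1) with s.
replace (- - (Ci * phase 0 0 L))%C with (2 * Ci * / L)%C by (unfold phase; ring).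
replace (- (Ci * phase 0 0 L))%C with (- (2 * Ci) * / L)%C by (unfold phase; ring).
replace (Ci * phase 0 0 L)%C with (2 * Ci * / L)%C by (unfold phase; ring).
assert (E : (Cexp (- (2 * Ci) * / L) * Cexp (2 * Ci * / L) = 1)%C).
  rewrite <- Cexp_plus, <- Cexp_0; f_equal; ring.
replace (- (4 * Ci) * / L)%C with (- (2 * Ci) * / L + - (2 * Ci) * / L)%C by ring.
replace (4 * Ci * / L)%C with (2 * Ci * / L + 2 * Ci * / L)%C by ring.
rewrite !Cexp_plus.
revert E; generalize (Cexp (- (2 * Ci) * / L)), (Cexp (2 * Ci * / L)); intros x y E.
f_equal; try ring; [transitivity (p * (x * y))%C | transitivity (s * (x * y))%C];
  try ring; rewrite E; ring.
Qed.

Lemma jump0_0 (G : M2) : jump0 G 0 = G.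
Proof.
rewrite (mat2_entries G) at 2; unfold jump0; rewrite !Cmult_0_r, Cexp_0; f_equal; ring.
Qed.

Lemma det2_jump0 (G : M2) (w : C) : det2 (jump0 G w) = det2 G.
Proof.
unfold jump0; rewrite det2E; unfold det2.
assert (E : (Cexp (- (4 * Ci) * w) * Cexp (4 * Ci * w) = 1)%C).
  rewrite <- Cexp_plus, <- Cexp_0; f_equal; ring.
transitivity (entry G 0 0 * entry G 1 1 - entry G 0 1 * entry G 1 0
  * (Cexp (- (4 * Ci) * w) * Cexp (4 * Ci * w)))%C; [ring | rewrite E; ring].
Qed.

Ltac two_cases i Hi :=
  destruct i as [|[|i]]; [| | exfalso; revert Hi; clear; lia]; clear Hi.

Lemma entry_mul2 (A B : M2) (i j : nat) : (i < 2)%nat -> (j < 2)%nat ->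
  entry (mul2 A B) i j = (entry A i 0 * entry B 0 j + entry A i 1 * entry B 1 j)%C.
Proof.
intros Hi Hj; rewrite (mat2_entries A), (mat2_entries B), mul2E.
two_cases i Hi; two_cases j Hj; reflexivity.
Qed.

Lemma mul2_assoc (A B D : M2) : mul2 (mul2 A B) D = mul2 A (mul2 B D).
Proof.
rewrite (mat2_entries A), (mat2_entries B), (mat2_entries D), !mul2E; f_equal; ring.
Qed.

Lemma mul2_id_l (A : M2) : mul2 id2 A = A.
Proof. rewrite (mat2_entries A), id2E, mul2E; f_equal; ring. Qed.

Lemma mul2_id_r (A : M2) : mul2 A id2 = A.
Proof. rewrite (mat2_entries A), id2E, mul2E; f_equal; ring. Qed.

Lemma cdiff_Cexp_lin (c w : C) : cdiff (fun w => Cexp (c * w))%C w.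
Proof.
apply (cdiff_comp Cexp (fun w => c * w)%C); [|apply cdiff_Cexp].
apply cdiff_mult; [apply cdiff_const | apply cdiff_id].
Qed.

Lemma cdiff_jump0 (G : M2) (i j : nat) (w : C) : (i < 2)%nat -> (j < 2)%nat ->
  cdiff (fun w => entry (jump0 G w) i j) w.
Proof.
intros Hi Hj; two_cases i Hi; two_cases j Hj.
- exact (cdiff_const (entry G 0 0) w).
- exact (cdiff_mult (fun _ => entry G 0 1) _ w (cdiff_const _ _) (cdiff_Cexp_lin _ _)).
- exact (cdiff_mult (fun _ => entry G 1 0) _ w (cdiff_const _ _) (cdiff_Cexp_lin _ _)).
- exact (cdiff_const (entry G 1 1) w).
Qed.

(** The determinant in the denominator is independent of [w], so each entry is a constant multiple
    of an entry of [jump0 G w]. *)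
Lemma cdiff_inv2_jump0 (G : M2) (i j : nat) (w : C) : (i < 2)%nat -> (j < 2)%nat ->
  cdiff (fun w => entry (inv2 (jump0 G w)) i j) w.
Proof.
intros Hi Hj.
assert (D : forall k l, (k < 2)%nat -> (l < 2)%nat ->
  cdiff (fun w => entry (jump0 G w) k l / det2 (jump0 G w))%C w).
  intros k l Hk Hl.
  apply (cdiff_ext_loc (fun w => entry (jump0 G w) k l * / det2 G)%C).
    apply filter_forall; intros u; now rewrite det2_jump0.
  apply cdiff_mult; [now apply cdiff_jump0 | apply cdiff_const].
assert (DN : forall k l, (k < 2)%nat -> (l < 2)%nat ->
  cdiff (fun w => - entry (jump0 G w) k l / det2 (jump0 G w))%C w).
  intros k l Hk Hl.
  apply (cdiff_ext_loc (fun w => - (entry (jump0 G w) k l / det2 (jump0 G w)))%C).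
    apply filter_forall; intros u; unfold Cdiv; ring.
  now apply cdiff_opp, D.
two_cases i Hi; two_cases j Hj.
- apply (D 1%nat 1%nat); lia.
- apply (DN 0%nat 1%nat); lia.
- apply (DN 1%nat 0%nat); lia.
- apply (D 0%nat 0%nat); lia.
Qed.

Lemma filterlim_Cinv_0 : filterlim Cinv C_infty (locally (RtoC 0)).
Proof.
generalize (filterlim_Cinv_infty 0); apply filterlim_ext; intros z; f_equal; ring.
Qed.

Lemma cdiff_lim_infty (f : C -> C) :
  cdiff f 0 -> filterlim (fun z => f (/ z)%C) C_infty (locally (f (RtoC 0))).
Proof.
intros Hf; apply (filterlim_comp _ _ _ Cinv f _ (locally (RtoC 0))).
- exact filterlim_Cinv_0.
- exact (cdiff_continuous f 0 Hf).
Qed.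

Lemma cdiff_comp_inv (f : C -> C) (z : C) :
  z <> RtoC 0 -> cdiff f (/ z)%C -> cdiff (fun z => f (/ z)%C) z.
Proof. intros Hz Hf; apply (cdiff_comp f Cinv); [now apply cdiff_inv | exact Hf]. Qed.

Lemma Cmod_pos_neq0 (z : C) : 0 < Cmod z -> z <> RtoC 0.
Proof. apply Cmod_gt_0. Qed.

Lemma locally_outside (z : C) : outside z -> locally z outside.
Proof.
intros Hz; apply locally_Cmod; unfold outside in *; exists (Cmod z - 1); split; [lra|].
intros w Hw; generalize (Cmod_sub_le w z); lra.
Qed.

Lemma locally_inside (z : C) : inside z -> locally z inside.
Proof.
intros Hz; apply locally_Cmod; unfold inside in *; exists (1 - Cmod z); split; [lra|].
intros w Hw; generalize (Cmod_sub_le z w); rewrite Cmod_sub_sym; lra.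
Qed.

Lemma continuous_within (D : C -> Prop) (f : C -> C) (z : C) :
  continuous f z -> filterlim f (within D (locally z)) (locally (f z)).
Proof. intros H; refine (filterlim_filter_le_1 _ _ H); apply (filter_le_within _). Qed.

(** * Existence: an explicit solution *)

Definition explicit_sol (G : M2) (z : C) : M2 :=
  if Rlt_dec 1 (Cmod z) then mul2 (inv2 G) (jump0 G (/ z)) else inv2 G.

Lemma explicit_sol_outside (G : M2) (z : C) :
  outside z -> explicit_sol G z = mul2 (inv2 G) (jump0 G (/ z)).
Proof. unfold outside, explicit_sol; destruct Rlt_dec; tauto. Qed.

Lemma explicit_sol_inside (G : M2) (z : C) : inside z -> explicit_sol G z = inv2 G.
Proof. unfold inside, explicit_sol; destruct Rlt_dec; [lra | trivial]. Qed.

Lemma cdiff_sol_outside (G : M2) (i j : nat) (w : C) : (i < 2)%nat -> (j < 2)%nat ->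
  cdiff (fun w => entry (mul2 (inv2 G) (jump0 G w)) i j) w.
Proof.
intros Hi Hj.
apply (cdiff_ext_loc (fun w => entry (inv2 G) i 0 * entry (jump0 G w) 0 j
                             + entry (inv2 G) i 1 * entry (jump0 G w) 1 j)%C).
  apply filter_forall; intros u; now rewrite entry_mul2.
apply cdiff_plus; apply cdiff_mult;
  first [apply cdiff_const | apply cdiff_jump0; auto with arith].
Qed.

(** Both pieces extend continuously to the circle, where they differ by the factor [jump0 G (/ z)],
    which is the jump. At infinity the exterior piece tends to [inv2 G] times [jump0 G 0 = G], the
    identity. *)
Lemma explicit_sol_RHP (G : M2) :
  det2 G <> RtoC 0 -> RHP 0 0 G (explicit_sol G).
Proof.
intros HG; split; [|split].
- intros z Hz i j Hi Hj; apply cdiff_ex_derive.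
  destruct (Rdichotomy _ _ Hz) as [Hin|Hout].
  + apply (cdiff_ext_loc (fun _ => entry (inv2 G) i j)); [|apply cdiff_const].
    generalize (locally_inside z Hin); apply filter_imp; intros w Hw.
    now rewrite explicit_sol_inside.
  + apply (cdiff_ext_loc (fun z => entry (mul2 (inv2 G) (jump0 G (/ z))) i j)).
      generalize (locally_outside z Hout); apply filter_imp; intros w Hw.
      now rewrite explicit_sol_outside.
    apply (cdiff_comp_inv (fun w => entry (mul2 (inv2 G) (jump0 G w)) i j)).
      apply Cmod_pos_neq0; lra.
    now apply cdiff_sol_outside.
- exists (fun z => mul2 (inv2 G) (jump0 G (/ z))), (fun _ => inv2 G); split; [|split].
  + intros z Hz i j Hi Hj.
    assert (Hc : continuous (fun z => entry (mul2 (inv2 G) (jump0 G (/ z))) i j) z).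
      apply cdiff_continuous.
      apply (cdiff_comp_inv (fun w => entry (mul2 (inv2 G) (jump0 G w)) i j)).
        apply Cmod_pos_neq0; rewrite Hz; lra.
      now apply cdiff_sol_outside.
    split; [|exact (continuous_within circle _ _ Hc)].
    apply (filterlim_within_ext outside (fun z => entry (mul2 (inv2 G) (jump0 G (/ z))) i j)).
      intros w Hw; now rewrite explicit_sol_outside.
    exact (continuous_within outside _ _ Hc).
  + intros z Hz i j Hi Hj; split; [|apply filterlim_const].
    apply (filterlim_within_ext inside (fun _ => entry (inv2 G) i j)); [|apply filterlim_const].
    intros w Hw; now rewrite explicit_sol_inside.
  + intros z Hz; now rewrite jump_origin.
- intros i j Hi Hj.
  replace id2 with (mul2 (inv2 G) (jump0 G 0)) by now rewrite jump0_0, inv2_l.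
  apply (filterlim_ext_loc (fun z => entry (mul2 (inv2 G) (jump0 G (/ z))) i j)).
    exists 1; intros z Hz; now rewrite explicit_sol_outside.
  apply (cdiff_lim_infty (fun w => entry (mul2 (inv2 G) (jump0 G w)) i j)).
  now apply cdiff_sol_outside.
Qed.

(** * Uniqueness of the solution outside the circle *)

Lemma filterlim_from_regions (f : C -> C) (z l : C) :
  filterlim f (within outside (locally z)) (locally l) ->
  filterlim f (within inside (locally z)) (locally l) ->
  filterlim f (within circle (locally z)) (locally l) ->
  filterlim f (locally z) (locally l).
Proof.
intros H1 H2 H3 Q HQ.
specialize (H1 Q HQ); specialize (H2 Q HQ); specialize (H3 Q HQ).
unfold filtermap, within in *.
generalize (filter_and _ _ (filter_and _ _ H1 H2) H3).
apply filter_imp; intros w [[K1 K2] K3].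
destruct (Rtotal_order (Cmod w) 1) as [H|[H|H]]; auto.
Qed.

(* Multiplying by the inverse jump outside removes the discontinuity on the
   circle, and the entries of the result tend to those of [inv2 G]. *)
Lemma RHP_outside (G : M2) (P : C -> M2) (z : C) :
  det2 G <> RtoC 0 -> RHP 0 0 G P -> outside z ->
  P z = mul2 (inv2 G) (jump0 G (/ z)).
Proof.
intros HG [Pdiff [[Vp [Vm [HVp [HVm Hjump]]]] Plim]] Hz.
set (J w := inv2 (jump0 G w)).
(* On the circle [P] is arbitrary, so [N] takes there the interior boundary value [Vm]. *)
set (N z := if Rlt_dec 1 (Cmod z) then mul2 (P z) (J (/ z))%C
            else if Rlt_dec (Cmod z) 1 then P z else Vm z).
assert (Nout : forall w, outside w -> N w = mul2 (P w) (J (/ w))%C).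
  intros w; unfold N, outside; destruct Rlt_dec; tauto.
assert (Nin : forall w, inside w -> N w = P w).
  intros w; unfold N, inside; destruct Rlt_dec; [lra|]; destruct Rlt_dec; tauto.
assert (Ncirc : forall w, circle w -> N w = Vm w).
  intros w; unfold N, circle; intros; destruct Rlt_dec; [lra|]; destruct Rlt_dec; [lra|trivial].
assert (Jdet : forall w, det2 (jump0 G w) <> RtoC 0) by (intros w; now rewrite det2_jump0).
assert (Pcdiff : forall w i j, Cmod w <> 1 -> (i < 2)%nat -> (j < 2)%nat ->
  cdiff (fun w => entry (P w) i j) w).
  intros w i j Hw Hi Hj; apply cdiff_ex_derive; auto.
assert (Jcdiff : forall w i j, w <> RtoC 0 -> (i < 2)%nat -> (j < 2)%nat ->
  cdiff (fun w => entry (J (/ w))%C i j) w).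
  intros w i j Hw Hi Hj; apply (cdiff_comp_inv (fun w => entry (J w) i j)); trivial.
  now apply cdiff_inv2_jump0.
assert (Ndiff : forall w i j, Cmod w <> 1 -> (i < 2)%nat -> (j < 2)%nat ->
  cdiff (fun w => entry (N w) i j) w).
  intros w i j Hw Hi Hj; destruct (Rdichotomy _ _ Hw) as [Hin|Hout].
  - apply (cdiff_ext_loc (fun w => entry (P w) i j)); auto.
    generalize (locally_inside w Hin); apply filter_imp; intros u Hu; now rewrite Nin.
  - apply (cdiff_ext_loc (fun w => entry (P w) i 0 * entry (J (/ w)) 0 j
                                 + entry (P w) i 1 * entry (J (/ w)) 1 j)%C).
      generalize (locally_outside w Hout); apply filter_imp; intros u Hu.
      now rewrite Nout, entry_mul2.
    assert (Hw0 : w <> RtoC 0) by (apply Cmod_pos_neq0; lra).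
    apply cdiff_plus; apply cdiff_mult; auto with arith.
assert (Ncont : forall i j w, (i < 2)%nat -> (j < 2)%nat ->
  continuous (fun w => entry (N w) i j) w).
  intros i j w Hi Hj; destruct (Req_dec (Cmod w) 1) as [Hw|Hw];
    [|apply cdiff_continuous; auto].
  unfold continuous; rewrite (Ncirc w Hw).
  apply filterlim_from_regions.
  - apply (filterlim_within_ext outside
      (fun w => entry (P w) i 0 * entry (J (/ w)) 0 j
              + entry (P w) i 1 * entry (J (/ w)) 1 j)%C).
      intros u Hu; now rewrite Nout, entry_mul2.
    (* The jump relation, solved for [Vm], says that the exterior limit of [N] is its value on the
       circle. *)
    replace (Vm w) with (mul2 (Vp w) (J (/ w))%C).
    2:{ rewrite Hjump, jump_origin, mul2_assoc by trivial; unfold J.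
        now rewrite inv2_r, mul2_id_r. }
    rewrite entry_mul2 by trivial.
    assert (Hw0 : w <> RtoC 0) by (apply Cmod_pos_neq0; lra).
    assert (HJ : forall k, (k < 2)%nat -> filterlim (fun w => entry (J (/ w))%C k j)
        (within outside (locally w)) (locally (entry (J (/ w))%C k j))).
      intros k Hk; apply (continuous_within outside (fun w => entry (J (/ w))%C k j)).
      apply cdiff_continuous; auto.
    apply filterlim_Cplus; apply filterlim_Cmult;
      [apply HVp | apply HJ | apply HVp | apply HJ]; auto with arith.
  - apply (filterlim_within_ext inside (fun w => entry (P w) i j)).
      intros u Hu; now rewrite Nin.
    apply HVm; trivial.
  (* Continuity of [Vm] along the circle is the second half of [boundary_value]. *)
  - apply (filterlim_within_ext circle (fun w => entry (Vm w) i j)).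
      intros u Hu; now rewrite Ncirc.
    apply HVm; trivial.
assert (Nlim : forall i j, (i < 2)%nat -> (j < 2)%nat ->
  filterlim (fun w => entry (N w) i j) C_infty (locally (entry (inv2 G) i j))).
  intros i j Hi Hj.
  apply (filterlim_ext_loc (fun w => entry (P w) i 0 * entry (J (/ w)) 0 j
                                   + entry (P w) i 1 * entry (J (/ w)) 1 j)%C).
    exists 1; intros w Hw; now rewrite Nout, entry_mul2.
  replace (inv2 G) with (mul2 id2 (J (RtoC 0))) by (unfold J; now rewrite jump0_0, mul2_id_l).
  rewrite entry_mul2 by trivial.
  assert (HJ : forall k, (k < 2)%nat -> filterlim (fun w => entry (J (/ w))%C k j)
      C_infty (locally (entry (J (RtoC 0)) k j))).
    intros k Hk; apply (cdiff_lim_infty (fun w => entry (J w) k j)).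
    now apply cdiff_inv2_jump0.
  apply filterlim_Cplus; apply filterlim_Cmult;
    [apply Plim | apply HJ | apply Plim | apply HJ]; auto with arith.
assert (Neq : forall i j, (i < 2)%nat -> (j < 2)%nat -> entry (N z) i j = entry (inv2 G) i j).
  intros i j Hi Hj; apply Cminus_eq0.
  apply (zero_of_vanishing_at_infty (fun w => entry (N w) i j - entry (inv2 G) i j)%C 1);
    [lra | | | | exact Hz].
  - intros w; apply filterlim_Cminus; [now apply Ncont | apply filterlim_const].
  - intros w Hw; apply cdiff_minus; [now apply Ndiff | apply cdiff_const].
  - replace (RtoC 0) with (entry (inv2 G) i j - entry (inv2 G) i j)%C by ring.
    apply filterlim_Cminus; [now apply Nlim | apply filterlim_const].
assert (NG : N z = inv2 G).
  rewrite (mat2_entries (N z)), (mat2_entries (inv2 G)).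
  f_equal; apply Neq; auto with arith.
rewrite <- NG, Nout, mul2_assoc by trivial.
unfold J; now rewrite inv2_l, mul2_id_r.
Qed.

(** * The value of [Psi] at the origin *)

Lemma entry_conj_sigma3 (G : M2) : det2 G <> RtoC 0 ->
  entry (mul2 (mul2 (inv2 G) sigma3) G) 0 1
  = (2 * (entry G 1 1 * entry G 0 1 / det2 G))%C.
Proof.
intros HG; rewrite entry_mul2, !entry_mul2 by lia.
change (entry (inv2 G) 0 0) with (entry G 1 1 / det2 G)%C.
change (entry (inv2 G) 0 1) with (- entry G 0 1 / det2 G)%C.
change (entry sigma3 0 0) with (RtoC 1); change (entry sigma3 0 1) with (RtoC 0).
change (entry sigma3 1 0) with (RtoC 0); change (entry sigma3 1 1) with (RtoC (- (1))).
rewrite RtoC_opp; field; exact HG.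
Qed.

(** Outside the circle the (1,2) entry of the solution is [k * (Cexp (- (4 * Ci) / z) - 1)], so [z]
    times it tends to [-4i * k]. Multiplying by [2i] gives [8 * k], while the conjugated [sigma3]
    has (1,2) entry [2 * k]. *)
Lemma Psi_origin (G : M2) : det2 G <> RtoC 0 ->
  Psi 0 0 G = (4 * entry (mul2 (mul2 (inv2 G) sigma3) G) 0 1)%C.
Proof.
intros HG.
(* The explicit solution supplies the existence under which [epsilon] returns a solution. *)
assert (HP : RHP 0 0 G (Psol 0 0 G)).
  unfold Psol; apply epsilon_spec; exists (explicit_sol G); now apply explicit_sol_RHP.
set (k := (entry G 1 1 * entry G 0 1 / det2 G)%C).
assert (Hout : forall z, 1 < Cmod z ->
  entry (Psol 0 0 G z) 0 1 = (k * (Cexp (- (4 * Ci) * / z) - 1))%C).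
  intros z Hz; rewrite (RHP_outside G _ z HG HP Hz), entry_mul2 by lia.
  change (entry (inv2 G) 0 0) with (entry G 1 1 / det2 G)%C.
  change (entry (inv2 G) 0 1) with (- entry G 0 1 / det2 G)%C.
  change (entry (jump0 G (/ z)%C) 0 1) with (entry G 0 1 * Cexp (- (4 * Ci) * / z))%C.
  change (entry (jump0 G (/ z)%C) 1 1) with (entry G 1 1).
  unfold k; field; exact HG.
assert (Hlim : filterlim (fun z => z * entry (Psol 0 0 G z) 0 1)%C C_infty
                 (locally (k * - (4 * Ci))%C)).
  destruct Cexp_slope as [s [Hs [Hs0 HE]]].
  replace (k * - (4 * Ci))%C with (k * - (4 * Ci) * s (RtoC 0))%C by (rewrite Hs0; ring).
  apply (filterlim_ext_loc (fun z => k * - (4 * Ci) * s (- (4 * Ci) * / z))%C).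
    exists 1; intros z Hz; rewrite Hout, (HE (- (4 * Ci) * / z)%C) by trivial.
    field; apply Cmod_pos_neq0; lra.
  apply filterlim_Cmult; [apply filterlim_const|].
  apply (filterlim_comp _ _ _ (fun z => - (4 * Ci) * / z)%C s _ (locally (RtoC 0))); trivial.
  replace (RtoC 0) with (- (4 * Ci) * 0)%C by ring.
  apply filterlim_Cmult; [apply filterlim_const | exact filterlim_Cinv_0].
transitivity (2 * Ci * (k * - (4 * Ci)))%C.
  apply (f_equal (Cmult (2 * Ci))).
  exact (@iota_filterlim_locally C_AbsRing C_CompleteNormedModule C C_infty _ _ _ Hlim).
rewrite entry_conj_sigma3 by trivial; unfold k.
transitivity (- (Ci * Ci) * (8 * (entry G 1 1 * entry G 0 1 / det2 G)))%C; [ring|].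
replace (Ci * Ci)%C with (- (1))%C; [field; exact HG|].
unfold Ci, Cmult, Copp, RtoC; simpl; f_equal; ring.
Qed.

Lemma Cexp_conj (z : C) : Cconj (Cexp z) = Cexp (Cconj z).
Proof.
destruct z as [x y]; unfold Cexp, Cconj; simpl; rewrite cos_neg, sin_neg; f_equal; ring.
Qed.

(** Conjugating the polar form negates the argument. At [z = 0] the modulus annihilates whatever
    [Carg] returns, which covers the case [a * b = 0]. *)
Lemma Cconj_polar (z : C) : Cconj z = (Cmod z * Cexp (- (Ci * Carg z)))%C.
Proof.
rewrite (Carg_polar z) at 1; rewrite Cmult_conj, Cexp_conj; f_equal.
- unfold Cconj, RtoC; simpl; f_equal; ring.
- f_equal; unfold Cconj, Copp, Cmult, Ci, RtoC; simpl; f_equal; ring.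
Qed.

Theorem theorem1p6 (a b : C) (hab : (a, b) <> (RtoC 0, RtoC 0)) :
  let G := Gmat a b in
  let fa : R := Cmod a / sqrt (Cmod a ^ 2 + Cmod b ^ 2) in
  let fb : R := Cmod b / sqrt (Cmod a ^ 2 + Cmod b ^ 2) in
  Psi 0 0 G = (4 * entry (mul2 (mul2 (inv2 G) sigma3) G) 0 1)%C
  /\ (4 * entry (mul2 (mul2 (inv2 G) sigma3) G) 0 1)%C
     = (8 * fa * fb * Cexp (- (Ci * Carg (a * b))))%C
  /\ (8 * fa * fb * Cexp (- (Ci * Carg (a * b))))%C
     = (8 * Cconj a * Cconj b / RtoC (Cmod a ^ 2 + Cmod b ^ 2))%C.
Proof.
intros G fa fb.
set (q := Cmod a ^ 2 + Cmod b ^ 2) in *.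
assert (Hq : 0 < q).
  assert (0 <= Cmod a) by apply Cmod_ge_0; assert (0 <= Cmod b) by apply Cmod_ge_0.
  destruct (Ceq_dec a 0) as [->|Ha].
    assert (Hb : b <> RtoC 0) by (intros ->; now apply hab).
    apply Cmod_gt_0 in Hb; unfold q; nra.
  apply Cmod_gt_0 in Ha; unfold q; nra.
assert (Hs : 0 < sqrt q) by now apply sqrt_lt_R0.
assert (Hss : sqrt q * sqrt q = q) by (apply sqrt_sqrt; lra).
assert (HsC : RtoC (sqrt q) <> RtoC 0) by (intros E; apply RtoC_inj in E; lra).
assert (HqC : (RtoC (sqrt q) * RtoC (sqrt q) = RtoC q)%C) by now rewrite <- RtoC_mult, Hss.
assert (Hnorm : (a * Cconj a + b * Cconj b = RtoC q)%C)
  by (unfold q; now rewrite RtoC_plus, <- !Cmod2_conj).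
assert (Hdet : det2 G = RtoC 1).
  transitivity ((a * Cconj a + b * Cconj b) / (RtoC (sqrt q) * RtoC (sqrt q)))%C.
    unfold G, Gmat; fold q; rewrite det2E; field; trivial.
  rewrite Hnorm, HqC; field; intros E; apply RtoC_inj in E; lra.
assert (Hpol : (8 * fa * fb * Cexp (- (Ci * Carg (a * b))))%C
     = (8 * Cconj a * Cconj b / RtoC q)%C).
  (* The product [fa * fb] is [Cmod (a * b) / q], so the exponential completes it to the polar form
     of [Cconj (a * b)] over [q]. *)
  transitivity (8 * Cconj (a * b) / RtoC q)%C; [|rewrite Cmult_conj, Cmult_assoc; trivial].
  rewrite Cconj_polar, Cmod_mult, <- HqC.
  unfold fa, fb; rewrite !RtoC_div, RtoC_mult by lra; field; trivial.
assert (Hdet0 : det2 G <> RtoC 0) by (rewrite Hdet; intros E; apply RtoC_inj in E; lra).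
split; [|split; trivial].
- now apply Psi_origin.
(* The polar expression is first replaced by the algebraic one, to which the (1,2) entry reduces by
   [field]. *)
- rewrite Hpol, entry_conj_sigma3, Hdet, <- HqC by trivial.
  change (entry G 1 1) with (Cconj a / RtoC (sqrt q))%C.
  change (entry G 0 1) with (Cconj b / RtoC (sqrt q))%C.
  field; trivial.
Qed.
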